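(* For any $n\ge1$, $k\ge1$ and $\lambda\vdash n$, $$\left(\prod_{i=1}^k(q_i;q_i)_n\right)s_\lambda\!\left[\frac{1}{(1-q_1)\cdots(1-q_k)}\right]=\sum_{P\in\mathcal{T}^k_\lambda}q^P.$$
   Context: $s_\lambda[1/((1-q_1)\cdots(1-q_k))]$ is $s_\lambda$ evaluated at all monomials $q_1^{a_1}\cdots q_k^{a_k}$, $a\in\mathbb{N}^k$. $(q;t)_r=(1-q)(1-qt)\cdots(1-qt^{r-1})$. $\epsilon$ is the identity of $S_n$; $\mathrm{SYT}(\lambda)$ the standard Young tableaux of shape $\lambda$; for such $T$, $\mathrm{des}(T)$ is the set of $i$ such that $i+1$ lies in a strictly lower row than $i$ (English notation). Definitions. $\mathbb{N}=\{0,1,\dots\}$; sequences in $\mathbb{N}^r$ compared lexicographically. For $R\subseteq\{1,\dots,n-1\}$ and distinct $a,b$, $a\sim_R b$ if all of $\min(a,b),\dots,\max(a,b)-1$ lie in $R$. For $S=(s^1,\dots,s^n)\in(\mathbb{N}^r)^n$ (if $r=0$ all $s^i$ empty and equal) and $\sigma\in S_n$, $\mathrm{Des}_{R,S}(\sigma)$ is the set of $i\in\{1,\dots,n-1\}$ with either $s^{\sigma_i}>s^{\sigma_{i+1}}$, or $s^{\sigma_i}=s^{\sigma_{i+1}}$ and either ($\sigma_{i+1}<\sigma_i$ and not $\sigma_{i+1}\sim_R\sigma_i$) or ($\sigma_{i+1}>\sigma_i$ and $\sigma_i\sim_R\sigma_{i+1}$). $Z_{R,\sigma}(S)\in(\mathbb{N}^{r+1})^n$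 prepends to each $s^j$ a first coordinate $z^j_1$ with $z^{\sigma_i}_1=\#\{j<i:j\in\mathrm{Des}_{R,S}(\sigma)\}$. For $T\in\mathrm{SYT}(\lambda)$ with $R=\mathrm{des}(T)$ and $\vec{\sigma}=(\sigma^1,\dots,\sigma^{k-1})\in S_n^{\times(k-1)}$, set $\sigma^k=\epsilon$, $Z^0=$ list of $n$ empty sequences, $Z^i=Z_{R,\sigma^i}(Z^{i-1})$; writing $Z^k=(z^1,\dots,z^n)\in(\mathbb{N}^k)^n$, $P_{T,\vec{\sigma}}$ is the tableau obtained from $T$ by replacing each entry $i$ by $z^i$. $\mathcal{T}^k_\lambda=\{P_{T,\vec\sigma}: T\in\mathrm{SYT}(\lambda),\ \vec\sigma\in S_n^{\times(k-1)}\}$ (a set). For a tableau $P$ with entries $s^1,\dots,s^n\in\mathbb{N}^k$, $q^P=\prod_{i=1}^k q_i^{\sum_j s^j_{k-i+1}}$. *)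

(* Defs.v *)
From mathcomp Require Import all_boot all_order all_algebra.
From mathcomp Require Import mpoly.
Set Implicit Arguments.
Unset Strict Implicit.
Unset Printing Implicit Defensive.
Import GRing.Theory.

(* A tableau is the list of its rows (English notation: row 0 on top). *)

Definition is_partition (la : seq nat) : bool :=
  sorted geq la && all (fun p => 0 < p) la.

Definition shape {X : Type} (t : seq (seq X)) : seq nat := map size t.

Definition tab_cond {X : Type} (x0 : X) (rowrel colrel : rel X)
  (t : seq (seq X)) : bool :=
  all (sorted rowrel) t &&
  all (fun r => all (fun c => colrel (nth x0 (nth [::] t r) c)
                                     (nth x0 (nth [::] t r.+1) c))
                    (iota 0 (size (nth [::] t r.+1))))
      (iota 0 (size t).-1).

Definition is_syt (n : nat) (la : seq nat) (t : seq (seq nat)) : bool :=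
  [&& shape t == la, perm_eq (flatten t) (iota 1 n) & tab_cond 0 ltn ltn t].

Fixpoint words {X : Type} (m : nat) (L : seq X) : seq (seq X) :=
  if m is m'.+1 then [seq x :: w | x <- L, w <- words m' L] else [:: [::]].

(* the list SYT(la) (every tableau of shape la is reshape la of its reading word) *)
Definition syts (n : nat) (la : seq nat) : seq (seq (seq nat)) :=
  [seq t <- [seq reshape la w | w <- permutations (iota 1 n)] | is_syt n la t].

Definition rowof (t : seq (seq nat)) (x : nat) : nat := find (fun r => x \in r) t.

Definition tdes (n : nat) (t : seq (seq nat)) : seq nat :=
  [seq i <- iota 1 n.-1 | rowof t i < rowof t i.+1].

Fixpoint lex_lt (a b : seq nat) : bool :=
  match a, b with
  | x :: a', y :: b' => (x < y) || ((x == y) && lex_lt a' b')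
  | _, _ => false
  end.

Definition lex_le (a b : seq nat) : bool := (a == b) || lex_lt a b.

(* The maps Z_{R,sigma}.  Permutations of {1..n} are lists sigma       *)
(* (one-line notation) with sigma_i = nth 0 sigma i.-1;                *)
(* S = (s^1,...,s^n) is a list with s^j = nth [::] S j.-1.             *)

Definition simR (R : seq nat) (a b : nat) : bool :=
  (a != b) && all (fun j => j \in R) (iota (minn a b) (maxn a b - minn a b)).

Definition sg (sigma : seq nat) (i : nat) : nat := nth 0 sigma i.-1.
Definition sv (S : seq (seq nat)) (j : nat) : seq nat := nth [::] S j.-1.

Definition is_DesRS (R : seq nat) (S : seq (seq nat)) (sigma : seq nat) (i : nat)
  : bool :=
  let a := sg sigma i in let b := sg sigma i.+1 in
  lex_lt (sv S b) (sv S a)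
  || ((sv S a == sv S b) &&
      (((b < a) && ~~ simR R b a) || ((a < b) && simR R a b))).

Definition DesRS (n : nat) (R : seq nat) (S : seq (seq nat)) (sigma : seq nat)
  : seq nat := [seq i <- iota 1 n.-1 | is_DesRS R S sigma i].

Definition Zmap (n : nat) (R : seq nat) (sigma : seq nat) (S : seq (seq nat))
  : seq (seq nat) :=
  [seq count (fun d => d < (index j sigma).+1) (DesRS n R S sigma) :: sv S j
  | j <- iota 1 n].

Definition Zfinal (n : nat) (R : seq nat) (sigmas : seq (seq nat)) : seq (seq nat) :=
  foldl (fun S sigma => Zmap n R sigma S) (nseq n [::]) (rcons sigmas (iota 1 n)).

Definition Ptab (n : nat) (t : seq (seq nat)) (sigmas : seq (seq nat))
  : seq (seq (seq nat)) :=
  let Z := Zfinal n (tdes n t) sigmas in map (map (sv Z)) t.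

Definition Tset (n k : nat) (la : seq nat) : seq (seq (seq (seq nat))) :=
  undup [seq Ptab n t sigmas
        | t <- syts n la, sigmas <- words k.-1 (permutations (iota 1 n))].

(* exponent of q^P: q_i gets sum_j s^j_{k-i+1}; with i : 'I_k (0-based),
   i stands for q_{i+1} and coordinate k-(i+1)+1 (1-based) is nth (k - i.+1). *)
Definition qexp (k : nat) (P : seq (seq (seq nat))) : 'X_{1..k} :=
  [multinom sumn [seq nth 0 s (k - i.+1) | s <- flatten P] | i < k].

Definition rhs_poly (n k : nat) (la : seq nat) : {mpoly int[k]} :=
  \sum_(P <- Tset n k la) 'X_[qexp k P].

Definition qpoch_prod (n k : nat) : {mpoly int[k]} :=
  \prod_(i < k) \prod_(j < n) (1 - 'X_i ^+ j.+1).

(* s_la[1/((1-q_1)...(1-q_k))]: s_la evaluated at the alphabet of all  *)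
(* monomials q^a, a in N^k.  With the combinatorial definition of      *)
(* Schur functions (sum over semistandard tableaux, the alphabet N^k   *)
(* totally ordered lexicographically), the coefficient of q^e is the   *)
(* number of SSYT of shape la with entries in N^k whose entries sum to *)
(* e.  Every entry of such a tableau is coordinatewise <= e, so we may *)
(* enumerate fillings with entries in the finite box {a : a <= e}.     *)
Fixpoint cprod (ls : seq (seq nat)) : seq (seq nat) :=
  if ls is l :: ls' then [seq x :: v | x <- l, v <- cprod ls'] else [:: [::]].

Definition box (k : nat) (e : 'X_{1..k}) : seq (seq nat) :=
  cprod [seq iota 0 (e i).+1 | i <- enum 'I_k].

Definition is_ssyt (la : seq nat) (t : seq (seq (seq nat))) : bool :=
  (shape t == la) && tab_cond [::] lex_le lex_lt t.

Definition weight_is (k : nat) (t : seq (seq (seq nat))) (e : 'X_{1..k}) : bool :=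
  all (fun a => size a == k) (flatten t) &&
  [forall i : 'I_k, sumn [seq nth 0 a i | a <- flatten t] == e i].

Definition schur_coef (k : nat) (la : seq nat) (e : 'X_{1..k}) : nat :=
  count (fun t => is_ssyt la t && weight_is t e)
        [seq reshape la w | w <- words (sumn la) (box e)].

Definition lhs_coef (n k : nat) (la : seq nat) (e : 'X_{1..k}) : int :=
  \sum_(m <- msupp (qpoch_prod n k) | (m <= e)%MM)
     (qpoch_prod n k)@_m * (schur_coef la (e - m)%MM)%:Z.

Arguments lhs_coef : clear implicits.
Arguments schur_coef : clear implicits.
Arguments weight_is : clear implicits.
Arguments box : clear implicits.

(* Main.v *)
Require Import Defs.
From mathcomp Require Import all_boot all_order all_algebra.
From mathcomp Require Import mpoly.
From mathcomp Require Import zify.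
Set Implicit Arguments.
Unset Strict Implicit.
Unset Printing Implicit Defensive.
Import GRing.Theory.

(** Refine the lexicographic preorder on positions defined by a sequence [S] of
    vectors to a total order, breaking ties by the order on labels that is
    increasing between the classes of [~_R] and decreasing inside them.  Then
    [Des_{R,S}(sigma)] is the set of descents of [sigma] for this order, and
    [sigma] lists the positions in the order defined by [Z_{R,sigma}(S)].
    Prepending an arbitrary coordinate [f] to [S] gives a new order, listed by a
    unique [sigma]; along [sigma] the values of [f] increase weakly, and strictly
    at the descents, so the [f] with a given [sigma] have generating function
    [q^|z| / (q;q)_n], where [z] is the coordinate prepended by [Z_{R,sigma}].
    Iterating [k] times and prescribing the last permutation to be the identity
    yields the generating function of the lexicographically weakly increasing
    sequences in [N^k] that increase strictly at [R].  Taking [R = des(T)] and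
    summing over [T] gives the Schur function, by standardization.

    The exponents of [q^P] read the coordinates of [N^k] backwards, whereas the
    Schur coefficients read them forwards: the two are matched by the symmetry of
    Schur polynomials.  All identities are proved between polynomials with
    coordinates truncated below [D], modulo monomials that do not divide [X^e]. *)

(** * Reindexing of finite sums and enumeration of words *)

Lemma big_bij_seq (R : nmodType) (I J : eqType) (s1 : seq I) (s2 : seq J)
    (h : I -> J) (g : J -> I) (F : I -> R) (G : J -> R) :
  uniq s1 -> uniq s2 ->
  {in s1, forall i, h i \in s2} -> {in s2, forall j, g j \in s1} ->
  {in s1, cancel h g} -> {in s2, cancel g h} ->
  {in s1, forall i, F i = G (h i)} ->
  (\sum_(i <- s1) F i = \sum_(j <- s2) G j)%R.
Proof.
move=> u1 u2 hh hg hK gK FG.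
rewrite (eq_big_seq _ FG) -(big_map h xpredT G); apply: perm_big.
apply: uniq_perm => //; first by rewrite map_inj_in_uniq //; apply: can_in_inj hK.
move=> j; apply/mapP/idP => [[i si ->]|sj]; first exact: hh.
by exists (g j); rewrite ?gK ?hg.
Qed.

Lemma mem_words (X : eqType) m (L : seq X) (w : seq X) :
  (w \in words m L) = (size w == m) && all (mem L) w.
Proof.
elim: m w => [|m IH] [|x w] //=.
  by apply/negP => /allpairsP[[y v] /= []].
rewrite eqSS andbCA -IH; apply/allpairsP/andP => [[[y v] /= [yL vm [-> ->]]]|[xL wm]] //.
by exists (x, w).
Qed.

Lemma words_uniq (X : eqType) m (L : seq X) : uniq L -> uniq (words m L).
Proof.
move=> uL; elim: m => //= m IH; apply: allpairs_uniq => // -[a b] [c d] _ _ /=.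
by case=> -> ->.
Qed.

Lemma words_rcons (X : eqType) m (L : seq X) : uniq L ->
  perm_eq (words m.+1 L) [seq rcons w x | w <- words m L, x <- L].
Proof.
move=> uL; apply: uniq_perm; first exact: words_uniq.
  apply: allpairs_uniq => //; first exact: words_uniq.
  by move=> [a b] [c d] _ _ /= /rcons_inj[-> ->].
move=> w; rewrite mem_words; apply/andP/allpairsP.
  case: (lastP w) => [[]|v x] //; rewrite size_rcons all_rcons eqSS => -[sv /andP[xL vL]].
  by exists (v, x); rewrite mem_words sv vL.
move=> [[v x] /= []]; rewrite mem_words => /andP[sv vL] xL ->.
by rewrite size_rcons all_rcons eqSS sv vL andbT; split.
Qed.

(** * The total order on labels induced by a sequence of vectors *)

Lemma refl_closure_trans (T : eqType) (lt : rel T) :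
  transitive lt -> transitive (fun a b => (a == b) || lt a b).
Proof.
move=> lt_trans b a c /orP[/eqP->//|ab] /orP[/eqP<-|bc]; rewrite ?ab ?orbT //.
by rewrite (lt_trans _ _ _ ab bc) orbT.
Qed.

Lemma index_sorted (T : eqType) (le : rel T) (s : seq T) (x y : T) :
  transitive le -> antisymmetric le -> sorted le s -> x \in s -> y \in s ->
  le x y -> index x s <= index y s.
Proof.
move=> tr anti srt xs ys xy; rewrite leqNgt; apply/negP => lt_yx.
have yx := sorted_ltn_index tr srt _ _ ys xs lt_yx.
by move: lt_yx; rewrite (anti x y) ?ltnn // xy yx.
Qed.

Lemma lex_lt_irr a : lex_lt a a = false.
Proof. by elim: a => //= x a ->; rewrite ltnn andbF. Qed.

Lemma lex_lt_trans : transitive lex_lt.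
Proof.
move=> b a c; elim: b a c => [|y b IH] [|x a] [|z c] //=.
case/orP=> [xy|/andP[/eqP-> ab]] /orP[yz|/andP[/eqP<- bc]]; try by lia.
by rewrite eqxx (IH _ _ ab bc) orbT.
Qed.

Lemma lex_lt_total a b : size a = size b ->
  [|| lex_lt a b, a == b | lex_lt b a].
Proof.
elim: a b => [|x a IH] [|y b] //= [/IH]; rewrite eqseq_cons.
by case: (ltngtP x y) => //= ->.
Qed.

(** Numbers the classes of [simR R] from left to right: passing from [j] to [j.+1] raises the count
    unless [j] lies in [R]. *)
Definition block (R : seq nat) (a : nat) : nat :=
  count (fun j => j \notin R) (iota 0 a).

Lemma blockD R a d : block R (a + d) = block R a + count (fun j => j \notin R) (iota a d).
Proof. by rewrite /block iotaD count_cat add0n. Qed.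

Lemma leq_block R a b : a <= b -> block R a <= block R b.
Proof. by move=> /subnKC <-; rewrite blockD leq_addr. Qed.

Lemma simR_block R a b : simR R a b = (a != b) && (block R a == block R b).
Proof.
rewrite /simR; case: (eqVneq a b) => //= _.
wlog ab : a b / a <= b => [H|].
  case/orP: (leq_total a b) => /H // {H}.
  by rewrite minnC maxnC => ->; rewrite eq_sym.
rewrite (minn_idPl ab) (maxn_idPr ab) -[in RHS](subnKC ab) blockD.
rewrite -[X in X == _]addn0 eqn_add2l eq_sym -leqn0 leqNgt -has_count -all_predC.
by apply: eq_all => j /=; rewrite negbK.
Qed.

Definition leS (R : seq nat) (S : seq (seq nat)) (a b : nat) : bool :=
  lex_lt (sv S a) (sv S b) ||
  ((sv S a == sv S b) &&
   ((block R a < block R b) || ((block R a == block R b) && (b <= a)))).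

Lemma leS_trans R S : transitive (leS R S).
Proof.
move=> b a c; rewrite /leS.
case/orP=> [ab|/andP[/eqP-> h1]] /orP[bc|/andP[/eqP<- h2]].
- by rewrite (lex_lt_trans ab bc).
- by rewrite ab.
- by rewrite bc.
- by apply/orP; right; rewrite eqxx /=; lia.
Qed.

Lemma leS_anti R S : antisymmetric (leS R S).
Proof.
move=> a b; rewrite /leS => /andP[].
case/orP=> [ab|/andP[/eqP-> h1]] /orP[bc|/andP[/eqP e h2]]; try by lia.
- by move: (lex_lt_trans ab bc); rewrite lex_lt_irr.
- by move: ab; rewrite e lex_lt_irr.
- by move: bc; rewrite lex_lt_irr.
Qed.

Lemma leS_total R S a b : size (sv S a) = size (sv S b) -> leS R S a b || leS R S b a.
Proof.
move=> /lex_lt_total; rewrite /leS => /or3P[->//|/eqP->|->]; last by rewrite !orbT.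
by rewrite eqxx lex_lt_irr /=; lia.
Qed.

Lemma leS_refl R S a : leS R S a a.
Proof. by rewrite /leS !eqxx leqnn /= !orbT. Qed.

(** When the vectors differ, both sides compare them. When they agree, monotonicity of [block] turns
    comparisons of labels into comparisons of classes: [b < a] in different classes puts [b] first,
    and so does [a < b] inside a class, where the order is reversed. *)
Lemma is_DesRS_leS R S sigma i :
  size (sv S (sg sigma i)) = size (sv S (sg sigma i.+1)) ->
  sg sigma i != sg sigma i.+1 ->
  is_DesRS R S sigma i = ~~ leS R S (sg sigma i) (sg sigma i.+1).
Proof.
rewrite /is_DesRS; move: (sg _ i) (sg _ i.+1) => a b /lex_lt_total tot ab.
rewrite !simR_block ab [b == a]eq_sym ab /leS.
have bl : a < b -> block R a <= block R b by move/ltnW/leq_block; apply.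
have bg : b < a -> block R b <= block R a by move/ltnW/leq_block; apply.
have [h|h] := boolP (lex_lt (sv S b) (sv S a)).
  have -> : lex_lt (sv S a) (sv S b) = false.
    by apply/negP => h'; move: (lex_lt_trans h h'); rewrite lex_lt_irr.
  have -> // : (sv S a == sv S b) = false.
  by apply/negP => /eqP e; move: h; rewrite e lex_lt_irr.
case: eqP tot => [->|_]; last by rewrite orbF (negPf h) orbF => ->.
by rewrite lex_lt_irr /= => _; lia.
Qed.

(** * Sequences of vectors and the listing of their positions *)

Definition vecs (n r : nat) (S : seq (seq nat)) : bool :=
  (size S == n) && all (fun s => size s == r) S.

Lemma size_sv n r S a : vecs n r S -> a \in iota 1 n -> size (sv S a) = r.
Proof.
case/andP=> /eqP sS /all_nthP sz; rewrite mem_iota => a1n.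
by rewrite /sv; apply/eqP/sz; lia.
Qed.

Definition listing (n : nat) (R : seq nat) (S : seq (seq nat)) : seq nat :=
  sort (leS R S) (iota 1 n).

Lemma listing_sorted n r R S : vecs n r S -> sorted (leS R S) (listing n R S).
Proof.
move=> vS; apply: (@sort_sorted_in _ (mem (iota 1 n))); last exact/allP.
by move=> a b ha hb; apply: leS_total; rewrite !(size_sv vS).
Qed.

Lemma perm_listing n R S : perm_eq (listing n R S) (iota 1 n).
Proof. by rewrite /listing perm_sort. Qed.

(** A total order sorts a set in only one way. Sortedness is the useful side, being a condition on
    neighbours in [tau]. *)
Lemma listingP n r R S tau : vecs n r S -> perm_eq tau (iota 1 n) ->
  (listing n R S == tau) = sorted (leS R S) tau.
Proof.
move=> vS pt; apply/eqP/idP => [<-|st]; first exact: listing_sorted vS.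
apply: (sorted_eq (@leS_trans R S) (@leS_anti R S)) => //.
  exact: listing_sorted vS.
by rewrite (perm_trans (perm_listing _ _ _)) // perm_sym.
Qed.

(** The order can be recovered from its listing alone, so sums over [S] can be organised by
    [listing n R S]; the induction on the number of coordinates rests on this. *)
Lemma leS_index n r R S a b : vecs n r S -> a \in iota 1 n -> b \in iota 1 n ->
  leS R S a b = (index a (listing n R S) <= index b (listing n R S)).
Proof.
move=> vS ha hb; have srt := listing_sorted R vS.
have [ma mb] : a \in listing n R S /\ b \in listing n R S.
  by rewrite !(perm_mem (perm_listing _ _ _)).
apply/idP/idP; first exact: index_sorted (@leS_trans R S) (@leS_anti R S) _ _ _.
exact: (sorted_leq_index (@leS_trans R S) (@leS_refl R S)).
Qed.

(** * Descent words and prepended coordinates *)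

Definition descent_word (le : rel nat) (tau : seq nat) : seq nat :=
  if tau is a :: s then 0 :: pairmap (fun x y => ~~ le x y : nat) a s else [::].

Lemma size_descent_word le tau : size (descent_word le tau) = size tau.
Proof. by case: tau => //= a s; rewrite size_pairmap. Qed.

Lemma eq_in_descent_word le le' tau :
  {in tau &, le =2 le'} -> descent_word le tau = descent_word le' tau.
Proof.
case: tau => //= a s H; congr cons.
elim: s a H => //= b s IH a H; rewrite H ?inE ?eqxx ?orbT //; congr cons.
by apply: IH => x y xs ys; apply: H; rewrite inE ?xs ?ys orbT.
Qed.

Definition prepend (f : seq nat) (S : seq (seq nat)) : seq (seq nat) :=
  [seq x.1 :: x.2 | x <- zip f S].

Lemma size_prepend f S : size f = size S -> size (prepend f S) = size S.
Proof. by move=> e; rewrite size_map size_zip e minnn. Qed.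

Lemma mem_zip_snd (A B : eqType) (s : seq A) (t : seq B) x :
  x \in zip s t -> x.2 \in t.
Proof.
elim: s t => [|a s IH] [|b t] //=; rewrite !inE => /orP[/eqP->|/IH ->] /=.
  by rewrite eqxx.
by rewrite orbT.
Qed.

Lemma vecs_prepend n r f S : vecs n r S -> size f = n -> vecs n r.+1 (prepend f S).
Proof.
case/andP=> /eqP sS aS sf; rewrite /vecs size_prepend ?sf ?sS // eqxx /=.
rewrite all_map; apply/allP => -[x s] /= /mem_zip_snd /(allP aS) /=.
by rewrite eqSS.
Qed.

Lemma sv_prepend n f S a : size f = n -> size S = n -> a \in iota 1 n ->
  sv (prepend f S) a = nth 0 f a.-1 :: sv S a.
Proof.
move=> sf sS; rewrite mem_iota => a1n; rewrite /sv /prepend.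
rewrite (nth_map (0, [::])) ?nth_zip ?sf ?sS //=.
by rewrite size_zip sf sS minnn; lia.
Qed.

(** The new coordinate is compared first and the old order settles ties: [f] has to rise weakly from
    [a] to [b], and strictly if the old order places [b] before [a]. One inequality with a
    correction of 0 or 1 covers both cases. *)
Lemma leS_prepend n R f S a b : size f = n -> size S = n ->
  a \in iota 1 n -> b \in iota 1 n ->
  leS R (prepend f S) a b = (nth 0 f a.-1 + ~~ leS R S a b <= nth 0 f b.-1).
Proof.
move=> sf sS ha hb; rewrite /leS !(sv_prepend sf sS) //= eqseq_cons.
case: (lex_lt (sv S a) _) => /=; rewrite ?andbT ?andbF ?orbF; first by lia.
case: (sv S a == _) => /=; rewrite ?andbT ?andbF ?orbF; last by lia.
by move: ((block R a < _) || _) => [] /=; lia.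
Qed.

(** Starting from [b], each step must rise by at least the entry of [ds]. For a descent word these
    are the P-partitions of a chain, and the pointwise least solution is the list of partial sums
    [scanl addn b ds]. *)
Fixpoint min_steps (ds : seq nat) (b : nat) (g : seq nat) : bool :=
  match ds, g with
  | d :: ds', x :: g' => (b + d <= x) && min_steps ds' x g'
  | [::], [::] => true
  | _, _ => false
  end.

Lemma min_steps_scanl ds b : min_steps ds b (scanl addn b ds).
Proof. by elim: ds b => //= d ds IH b; rewrite leqnn IH. Qed.

Lemma sorted_leS_prepend n R f S tau : size f = n -> size S = n ->
  {subset tau <= iota 1 n} ->
  sorted (leS R (prepend f S)) tau =
  min_steps (descent_word (leS R S) tau) 0 [seq nth 0 f j.-1 | j <- tau].
Proof.
move=> sf sS; case: tau => //= a s.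
elim: s a => //= b s IH a sub.
rewrite (leS_prepend R sf sS) ?sub ?inE ?eqxx ?orbT //; congr andb; apply: IH.
by move=> x xs; apply: sub; rewrite inE xs orbT.
Qed.

(** The leading 0 of the descent word accounts for the first position, so its partial sum at the
    0-based index [i] counts the descents before the 1-based position [i.+1]. *)
Lemma count_descents le tau i : i < size tau ->
  count (fun d => d < i.+1)
    [seq d <- iota 1 (size tau).-1 | ~~ le (sg tau d) (sg tau d.+1)] =
  nth 0 (scanl addn 0 (descent_word le tau)) i.
Proof.
case: tau => // a s; rewrite [size _]/= ltnS => ilt.
have cE j : j <= size s ->
  count (fun d => d < j.+1)
    [seq d <- iota 1 (size s) | ~~ le (sg (a :: s) d) (sg (a :: s) d.+1)] =
  count (fun d => ~~ le (sg (a :: s) d) (sg (a :: s) d.+1)) (iota 1 j).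
  move=> jle; rewrite count_filter -[in iota 1 (size s)](subnKC jle) iotaD count_cat.
  rewrite [X in _ + X](eq_in_count (a2 := pred0)); last first.
    by move=> d; rewrite mem_iota /=; lia.
  rewrite count_pred0 addn0; apply: eq_in_count => d.
  by rewrite mem_iota /=; lia.
rewrite cE //.
have -> : scanl addn 0 (descent_word le (a :: s)) =
    0 :: scanl addn 0 (pairmap (fun x y => ~~ le x y : nat) a s) by rewrite /= addn0.
elim: i ilt => [|i IH] ilt //.
have {}IH := IH (ltnW ilt); rewrite -[in iota _ _](addn1 i) iotaD count_cat IH /= addn0.
rewrite (nth_cons_scanl 0 addn) ?size_pairmap; last exact: ltnW.
rewrite (nth_scanl 0 addn) ?size_pairmap // (take_nth 0) ?size_pairmap //.
by rewrite foldl_rcons (nth_pairmap 0).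
Qed.

(** By [is_DesRS_leS] the descents are those for the order [leS R S], and counting them gives the
    partial sums of the descent word. So the map prepends the least coordinate compatible with
    [sigma]. *)
Lemma Zmap_prepend n r R S sigma : vecs n r S -> perm_eq sigma (iota 1 n) ->
  Zmap n R sigma S =
  prepend [seq nth 0 (scanl addn 0 (descent_word (leS R S) sigma)) (index j sigma) |
              j <- iota 1 n] S.
Proof.
move=> vS ps; have [/eqP sS _] := andP vS.
have ss : size sigma = n by rewrite (perm_size ps) size_iota.
have us : uniq sigma by rewrite (perm_uniq ps) iota_uniq.
have DE : DesRS n R S sigma =
    [seq d <- iota 1 (size sigma).-1 | ~~ leS R S (sg sigma d) (sg sigma d.+1)].
  rewrite ss; apply: eq_in_filter => d; rewrite mem_iota => hd.
  have hm i : 0 < i -> i <= n -> sg sigma i \in iota 1 n.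
    by move=> i0 i_n; rewrite -(perm_mem ps) mem_nth // ss; lia.
  apply: is_DesRS_leS; first by rewrite !(size_sv vS) // hm //; lia.
  by rewrite /sg nth_uniq ?ss //=; lia.
apply: (@eq_from_nth _ [::]) => [|i].
  by rewrite size_prepend size_map ?size_iota.
rewrite size_map size_iota => i_n.
rewrite -[RHS]/(sv _ i.+1) (@sv_prepend n) ?size_map ?size_iota //; last first.
  by rewrite mem_iota; lia.
rewrite /= !(nth_map 0) ?size_iota // nth_iota // add1n /sv /=; congr cons.
by rewrite DE count_descents // index_mem (perm_mem ps) mem_iota; lia.
Qed.

Lemma vecs_Zmap n r R S sigma : vecs n r S -> perm_eq sigma (iota 1 n) ->
  vecs n r.+1 (Zmap n R sigma S).
Proof.
by move=> vS ps; rewrite (Zmap_prepend R vS ps) vecs_prepend // size_map size_iota.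
Qed.

Lemma Zmap_along n (tau zs : seq nat) : perm_eq tau (iota 1 n) -> size zs = n ->
  [seq nth 0 [seq nth 0 zs (index j tau) | j <- iota 1 n] j.-1 | j <- tau] = zs.
Proof.
move=> pt sz; have st : size tau = n by rewrite (perm_size pt) size_iota.
have ut : uniq tau by rewrite (perm_uniq pt) iota_uniq.
apply: (@eq_from_nth _ 0) => [|i]; rewrite size_map ?sz // st => i_n.
rewrite (nth_map 0) ?st //.
have : nth 0 tau i \in iota 1 n by rewrite -(perm_mem pt) mem_nth ?st.
rewrite mem_iota => h; rewrite (nth_map 0) ?size_iota; last by lia.
rewrite nth_iota; last by lia.
have -> : 1 + (nth 0 tau i).-1 = nth 0 tau i by lia.
by rewrite index_uniq ?st.
Qed.

(** Along [sigma] the prepended coordinate consists of the partial sums, which meet every bound of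
    [min_steps] with equality. Hence [sigma] sorts the new order and can be read off from the
    image. *)
Lemma listing_Zmap n r R S sigma : vecs n r S -> perm_eq sigma (iota 1 n) ->
  listing n R (Zmap n R sigma S) = sigma.
Proof.
move=> vS ps; apply/eqP; rewrite (listingP _ (vecs_Zmap R vS ps) ps).
have [/eqP sS _] := andP vS.
rewrite (Zmap_prepend R vS ps) (@sorted_leS_prepend n) ?size_map ?size_iota //; last first.
  by move=> x; rewrite (perm_mem ps).
rewrite Zmap_along ?min_steps_scanl // size_scanl size_descent_word.
by rewrite (perm_size ps) size_iota.
Qed.

(** * Generating functions modulo high degrees *)

Definition eqc (k : nat) (e : 'X_{1..k}) (p q : {mpoly int[k]}) : Prop :=
  forall d : 'X_{1..k}, (d <= e)%MM -> (p@_d = q@_d)%R.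

Lemma eqc_trans k (e : 'X_{1..k}) p q r : eqc e p q -> eqc e q r -> eqc e p r.
Proof. by move=> pq qr d de; rewrite pq // qr. Qed.

Lemma eqc_sum k (e : 'X_{1..k}) (I : eqType) (s : seq I) (F G : I -> {mpoly int[k]}) :
  {in s, forall i, eqc e (F i) (G i)} ->
  eqc e (\sum_(i <- s) F i)%R (\sum_(i <- s) G i)%R.
Proof.
move=> FG d de; rewrite !raddf_sum /=.
by apply: eq_big_seq => i si; apply: FG.
Qed.

(** A coefficient of a product at [d] involves only coefficients of the factors at divisors of [d],
    and these are again below [e]. *)
Lemma eqc_mull k (e : 'X_{1..k}) (r p q : {mpoly int[k]}) :
  eqc e p q -> eqc e (r * p)%R (r * q)%R.
Proof.
move=> pq d de; rewrite !mcoeffM; apply: eq_bigr => -[m1 m2] /= /eqP dE.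
congr (_ * _)%R; apply: pq; apply/mnm_lepP => i.
by move/mnm_lepP: de => /(_ i); apply: leq_trans; rewrite [in leqRHS]dE mnmDE leq_addl.
Qed.

Lemma eqc_monomial0 k (e m : 'X_{1..k}) (i : 'I_k) : e i < m i ->
  eqc e 'X_[m] 0%R.
Proof.
move=> lt d /mnm_lepP /(_ i) de; rewrite mcoeffX mcoeff0.
by case: eqP => // E; move: lt; rewrite E ltnNge de.
Qed.

Lemma sumn_scanl_addn b ds :
  sumn (scanl addn b ds) = size ds * b + sumn (scanl addn 0 ds).
Proof.
elim: ds b => //= d ds IH b; rewrite IH [in RHS]IH; nia.
Qed.

Lemma sum_words_cons (A : nmodType) (X : eqType) m (L : seq X) (P : pred (seq X))
    (F : seq X -> A) :
  (\sum_(w <- words m.+1 L | P w) F w =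
   \sum_(x <- L) \sum_(w <- words m L | P (x :: w)) F (x :: w))%R.
Proof.
rewrite big_mkcond big_allpairs_dep /=; apply: eq_bigr => x _.
by rewrite [RHS]big_mkcond.
Qed.

(** Induction along the chain: once the first value is [x], the remaining [m] values contribute q^(m
    x + c) after multiplication by their factors, and the geometric series in [x] starting at
    [b + d] is cancelled by the last factor 1 - q^(m+1). The hypothesis on [q] removes the effect of
    truncating at [D]. *)
Lemma chain_gf k (e : 'X_{1..k}) (q : {mpoly int[k]}) D ds b :
  (forall a, D <= a -> eqc e (q ^+ a)%R 0%R) ->
  eqc e ((\prod_(j < size ds) (1 - q ^+ j.+1)) *
         \sum_(g <- words (size ds) (iota 0 D) | min_steps ds b g) q ^+ sumn g)%R
        (q ^+ sumn (scanl addn b ds))%R.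
Proof.
move=> q0; elim: ds b => [|d ds IH] b.
  by move=> c ce; rewrite big_ord0 mul1r /= big_cons big_nil /= addr0.
set m := size ds in IH *; set c := sumn (scanl addn 0 ds).
have -> : sumn (scanl addn b (d :: ds)) = m.+1 * (b + d) + c.
  by rewrite /= sumn_scanl_addn -/m -/c; lia.
rewrite [size (_ :: _)]/= -/m big_ord_recr /= sum_words_cons.
(* The factor 1 - q^(m+1) goes outside; the other factors act on the inner sums, where the induction
   hypothesis applies. *)
rewrite mulrAC -mulrA [X in (_ * X)%R]mulrC mulrCA.
have step : eqc e
    (\prod_(j < m) (1 - q ^+ j.+1) * \sum_(x <- iota 0 D)
       \sum_(w <- words m (iota 0 D) | min_steps (d :: ds) b (x :: w))
          q ^+ sumn (x :: w))%R
    (\sum_(x <- iota 0 D) if (b + d <= x)%N then q ^+ (m.+1 * x + c) else 0)%R.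
  rewrite mulr_sumr; apply: eqc_sum => x _ /=.
  case: ifP => bx /=; last by rewrite big_pred0_eq mulr0.
  have := IH x; rewrite sumn_scanl_addn -/m -/c => /(eqc_mull (q ^+ x)%R) H.
  move=> f fe; move: (H f fe); rewrite -exprD mulSn -addnA => <-.
  congr (_@__)%R; rewrite mulrCA; congr (_ * _)%R; rewrite mulr_sumr.
  by apply: eq_bigr => w _; rewrite exprD.
apply: eqc_trans (eqc_mull _ step) _ => {step IH}.
set B := b + d.
(* A telescoping geometric sum, empty until [D'] exceeds [B]; at [B = D'] the two terms of the
   right-hand side cancel. *)
have tele D' : ((1 - q ^+ m.+1) *
    \sum_(x <- iota 0 D') (if (B <= x)%N then q ^+ (m.+1 * x + c) else 0) =
    if (B <= D')%N then q ^+ (m.+1 * B + c) - q ^+ (m.+1 * D' + c) else 0)%R.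
  elim: D' => [|D' IH].
    by rewrite big_nil mulr0; case: B => //=; rewrite subrr.
  rewrite -[in iota _ _](addn1 D') iotaD big_cat /= big_cons big_nil addr0.
  rewrite mulrDr IH add0n.
  case: (ltngtP B D'.+1) => h.
  - have -> : B <= D' by lia.
    by rewrite mulrBl mul1r -exprD mulnS -addnA addrA subrK.
  - have -> : B <= D' = false by lia.
    by rewrite mulr0 addr0.
  - have -> : B <= D' = false by lia.
    by rewrite mulr0 addr0 h subrr.
(* If [B <= D], the remainder of the telescoping has exponent at least [D]; otherwise the sum is
   empty and the target itself has exponent at least [D]. Both vanish modulo [e]. *)
rewrite tele; case: (leqP B D) => BD f fe.
  rewrite mcoeffB (q0 (m.+1 * D + c)) //; last by lia.
  by rewrite mcoeff0 subr0.
by rewrite mcoeff0 q0 ?mcoeff0 //; nia.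
Qed.

Lemma sumn_perm s t : perm_eq s t -> sumn s = sumn t.
Proof. by move=> st; rewrite !sumnE; apply: perm_big. Qed.

Lemma map_nth_pred n (A : Type) (x : A) (f : seq A) : size f = n ->
  [seq nth x f j.-1 | j <- iota 1 n] = f.
Proof.
move=> sf; apply: (@eq_from_nth _ x) => [|i]; rewrite size_map size_iota ?sf // => i_n.
by rewrite (nth_map 0) ?size_iota // nth_iota.
Qed.

(** Reading [f] along [tau] is a bijection on words that preserves the sum and turns the condition
    on the listing into [min_steps] for the descent word; [chain_gf] then applies. *)
Lemma listing_gf k (e : 'X_{1..k}) (q : {mpoly int[k]}) D n r R S tau :
  (forall a, D <= a -> eqc e (q ^+ a)%R 0%R) ->
  vecs n r S -> perm_eq tau (iota 1 n) ->
  eqc e ((\prod_(j < n) (1 - q ^+ j.+1)) *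
         \sum_(f <- words n (iota 0 D) | listing n R (prepend f S) == tau) q ^+ sumn f)%R
        (q ^+ sumn (scanl addn 0 (descent_word (leS R S) tau)))%R.
Proof.
move=> q0 vS pt; have [/eqP sS _] := andP vS.
have st : size tau = n by rewrite (perm_size pt) size_iota.
have ut : uniq tau by rewrite (perm_uniq pt) iota_uniq.
have := chain_gf (descent_word (leS R S) tau) 0 q0; rewrite size_descent_word st.
congr (eqc e (_ * _)%R _); rewrite big_mkcond [RHS]big_mkcond /=; symmetry.
have memt j : j \in tau -> 0 < j <= n.
  by rewrite (perm_mem pt) mem_iota; lia.
apply: (big_bij_seq (h := fun f => [seq nth 0 f j.-1 | j <- tau])
   (g := fun g => [seq nth 0 g (index j tau) | j <- iota 1 n])).
- by apply: words_uniq; apply: iota_uniq.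
- by apply: words_uniq; apply: iota_uniq.
- move=> f; rewrite !mem_words size_map st eqxx /= => /andP[/eqP sf /allP af].
  rewrite all_map; apply/allP => j /memt hj /=; apply/af/mem_nth; rewrite sf; lia.
- move=> g; rewrite !mem_words size_map size_iota eqxx /= => /andP[/eqP sg /allP ag].
  rewrite all_map; apply/allP => j hj /=; apply/ag/mem_nth.
  by rewrite sg -st index_mem (perm_mem pt).
- move=> f; rewrite mem_words => /andP[/eqP sf _].
  rewrite -[RHS](map_nth_pred 0 sf); apply/eq_in_map => j hj.
  have jt : j \in tau by rewrite (perm_mem pt).
  by rewrite (nth_map 0) ?index_mem // nth_index.
- by move=> g; rewrite mem_words => /andP[/eqP sg _]; apply: Zmap_along.
- move=> f; rewrite mem_words => /andP[/eqP sf _].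
  rewrite (listingP _ (vecs_prepend vS sf) pt) (sorted_leS_prepend _ sf sS); last first.
    by move=> x; rewrite (perm_mem pt).
  congr (if _ then (q ^+ _)%R else _).
  by rewrite -[in LHS](map_nth_pred 0 sf); apply/sumn_perm/perm_map; rewrite perm_sym.
Qed.

(** * Iteration over the coordinates *)

Lemma vecs_words n r D S : S \in words n (words r (iota 0 D)) -> vecs n r S.
Proof.
rewrite mem_words /vecs => /andP[-> /= aS]; apply: sub_all aS => s /=.
by rewrite mem_words => /andP[].
Qed.

Lemma prepend_inj n f f' S S' : size f = n -> size S = n -> size f' = n -> size S' = n ->
  prepend f S = prepend f' S' -> f = f' /\ S = S'.
Proof.
move=> sf sS sf' sS' E; split.
  have := congr1 (map (head 0)) E; rewrite -!map_comp /=.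
  by rewrite -!/(unzip1 _) !unzip1_zip ?sf ?sS ?sf' ?sS'.
have := congr1 (map behead) E; rewrite -!map_comp /=.
by rewrite -!/(unzip2 _) !unzip2_zip ?sf ?sS ?sf' ?sS'.
Qed.

Lemma sum_words_prepend (A : nmodType) n r (L : seq nat) (F : seq (seq nat) -> A) : uniq L ->
  (\sum_(S <- words n (words r.+1 L)) F S =
   \sum_(S <- words n (words r L)) \sum_(f <- words n L) F (prepend f S))%R.
Proof.
move=> uL;
transitivity (\sum_(S <- [seq prepend f S0 | S0 <- words n (words r L), f <- words n L]) F S)%R;
  last by rewrite big_allpairs_dep.
apply: perm_big; apply: uniq_perm.
- by do 2!apply: words_uniq.
- apply: allpairs_uniq; try by do ?apply: words_uniq.
  move=> [S f] [S' f'] /allpairsP[[? ?] /= [hS hf [-> ->]]].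
  move=> /allpairsP[[? ?] /= [hS' hf' [-> ->]]].
  move: hS hf hS' hf'; rewrite !mem_words => /andP[/eqP a _] /andP[/eqP b _].
  by move=> /andP[/eqP a' _] /andP[/eqP b' _] /(prepend_inj b a b' a')[-> ->].
move=> S; rewrite mem_words; apply/andP/allpairsP => [[/eqP sS /allP aS]|].
  have aS' s : s \in S -> [/\ s = head 0 s :: behead s, size (behead s) = r,
       head 0 s \in L & all (mem L) (behead s)].
    move/aS => hs; have : s \in words r.+1 L by [].
    rewrite mem_words {hs}; case: s => //= x s /andP[/eqP[]] -> /andP[-> ->].
    by split.
  exists (map behead S, map (head 0) S); rewrite /= !mem_words !size_map sS eqxx /=.
  split.
  - rewrite all_map; apply/allP => s /aS' [_ sz _ al] /=.
    by rewrite mem_words sz eqxx.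
  - by rewrite all_map; apply/allP => s /aS' [].
  rewrite /prepend zip_map -map_comp -[LHS]map_id; apply/eq_in_map => s /aS' [] //.
move=> [[S' f] /= []]; rewrite !mem_words => /andP[/eqP sS' /allP aS'] /andP[/eqP sf /allP af] ->.
rewrite size_prepend ?sf ?sS' //; split => //; rewrite all_map; apply/allP => -[x s] xs /=.
have : s \in words r L by apply: aS'; apply: mem_zip_snd xs.
rewrite -/(words r.+1 L) !mem_words /= => /andP[/eqP -> ->].
have xf : x \in f.
  by have := map_f fst xs; rewrite -/(unzip1 _) unzip1_zip // sf sS'.
by rewrite eqxx andbT; apply: af xf.
Qed.

(** A coordinate is paired with the variable numbered by how many coordinates follow it. Counting
    from the end keeps the variables of the old coordinates fixed under [prepend], and it is the
    reversed reading used by q^P. *)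
Fixpoint wvec (A : pzSemiRingType) (v : nat -> A) (a : seq nat) : A :=
  if a is c :: a' then (v (size a') ^+ c * wvec v a')%R else 1%R.

Lemma prod_wvec_prepend (A : comPzSemiRingType) (v : nat -> A) n r f S :
  vecs n r S -> size f = n ->
  (\prod_(s <- prepend f S) wvec v s = v r ^+ sumn f * \prod_(s <- S) wvec v s)%R.
Proof.
case/andP=> /eqP <- {n}.
elim: S f => [|s S IH] [|c f] //=; first by rewrite /prepend /= !big_nil mulr1.
case/andP=> /eqP sr aS [] sf; rewrite /prepend /= !big_cons /= -/(prepend f S) IH // sr exprD.
by rewrite mulrACA.
Qed.

Definition Zfold (n : nat) (R : seq nat) (sigmas : seq (seq nat)) : seq (seq nat) :=
  foldl (fun S sigma => Zmap n R sigma S) (nseq n [::]) sigmas.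

Lemma Zfold_rcons n R sigmas sigma :
  Zfold n R (rcons sigmas sigma) = Zmap n R sigma (Zfold n R sigmas).
Proof. by rewrite /Zfold foldl_rcons. Qed.

Lemma vecs_Zfold n r R sigmas : sigmas \in words r (permutations (iota 1 n)) ->
  vecs n r (Zfold n R sigmas).
Proof.
rewrite mem_words => /andP[/eqP <- {r}].
elim/last_ind: sigmas => [_|w x IH].
  by rewrite /vecs size_nseq eqxx /=; apply/allP => s /nseqP[->].
rewrite all_rcons /= mem_permutations => /andP[px aw].
by rewrite Zfold_rcons size_rcons; apply: vecs_Zmap => //; apply: IH.
Qed.

(** Induction on the number of coordinates, for an arbitrary function [phi] of the listing. Summing
    over the newest coordinate leaves a weight that depends on [S] only through its listing, so it
    is absorbed into a new function to which the induction hypothesis applies. *)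
Lemma sum_listing_gf k (e : 'X_{1..k}) (v : nat -> {mpoly int[k]}) D n R r
    (phi : seq nat -> {mpoly int[k]}) :
  (forall i, i < r -> forall a, D <= a -> eqc e (v i ^+ a)%R 0%R) ->
  eqc e
   ((\prod_(i < r) \prod_(j < n) (1 - v i ^+ j.+1)) *
    \sum_(S <- words n (words r (iota 0 D)))
       phi (listing n R S) * \prod_(s <- S) wvec v s)%R
   (\sum_(sigmas <- words r (permutations (iota 1 n)))
       phi (listing n R (Zfold n R sigmas)) * \prod_(s <- Zfold n R sigmas) wvec v s)%R.
Proof.
elim: r phi => [|r IH] phi hv.
  move=> d de; rewrite big_ord0 mul1r /= /Zfold /= big_cons big_nil addr0.
  suff -> : words n [:: [::]] = [:: nseq n [::]] by rewrite big_cons big_nil addr0.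
  by move=> A; elim: n => //= n ->.
have {}IH phi := IH phi (fun i ir => hv i (ltnW ir)).
set perms := permutations (iota 1 n).
have uperms : uniq perms by apply: permutations_uniq.
(* The exponent produced by [listing_gf], expressed through the listing [tau'] of [S] instead of
   [S]; [cmE] below justifies this. *)
pose cm tau' tau := sumn (scanl addn 0
  (descent_word (fun a b => index a tau' <= index b tau') tau)).
pose phi' tau' := (\sum_(tau <- perms) phi tau * v r ^+ cm tau' tau)%R.
have cmE S tau : vecs n r S -> tau \in perms ->
    sumn (scanl addn 0 (descent_word (leS R S) tau)) = cm (listing n R S) tau.
  move=> vS; rewrite mem_permutations => pt; congr (sumn (scanl _ _ _)).
  by apply: eq_in_descent_word => a b ha hb; rewrite (leS_index _ vS) -?(perm_mem pt).
rewrite big_ord_recr /=; set Pr := (\prod_(i < r) _)%R; set Pn := (\prod_(j < n) _)%R.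
(* On the side of permutations, [phi'] collects the last one, [tau]: it lists the final sequence,
   and the coordinate it prepends has sum [cm]. *)
have -> : (\sum_(sigmas <- words r.+1 perms)
       phi (listing n R (Zfold n R sigmas)) * \prod_(s <- Zfold n R sigmas) wvec v s =
   \sum_(sigmas <- words r perms)
       phi' (listing n R (Zfold n R sigmas)) * \prod_(s <- Zfold n R sigmas) wvec v s)%R.
  rewrite (perm_big _ (words_rcons r uperms)) big_allpairs_dep /=.
  apply: eq_big_seq => sg hsg; rewrite mulr_suml; apply: eq_big_seq => tau ht.
  have vS := vecs_Zfold R hsg; have pt : perm_eq tau (iota 1 n) by rewrite -mem_permutations.
  rewrite Zfold_rcons (listing_Zmap _ vS pt) (Zmap_prepend _ vS pt).
  rewrite (prod_wvec_prepend _ vS) ?size_map ?size_iota // -cmE //.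
  rewrite [sumn [seq _ | j <- _]](_ : _ =
      sumn (scanl addn 0 (descent_word (leS R (Zfold n R sg)) tau))).
    by rewrite mulrA.
  rewrite -{2}(Zmap_along pt
    (zs := scanl addn 0 (descent_word (leS R (Zfold n R sg)) tau))); last first.
    by rewrite size_scanl size_descent_word (perm_size pt) size_iota.
  set zs := [seq _ | j <- iota 1 n].
  rewrite -[in LHS](@map_nth_pred n _ 0 zs) ?size_map ?size_iota //.
  by apply/sumn_perm/perm_map; rewrite perm_sym.
apply: eqc_trans (IH phi').
rewrite sum_words_prepend ?iota_uniq // -mulrA; apply: eqc_mull.
rewrite mulr_sumr; apply: eqc_sum => S hS; have vS := vecs_words hS.
(* The coordinates [f] are grouped by the listing [tau] of the extended sequence. *)
have -> : (\sum_(f <- words n (iota 0 D))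
     phi (listing n R (prepend f S)) * \prod_(s <- prepend f S) wvec v s =
   (\prod_(s <- S) wvec v s) * \sum_(tau <- perms) phi tau *
      \sum_(f <- words n (iota 0 D) | listing n R (prepend f S) == tau) v r ^+ sumn f)%R.
  have -> : (\sum_(tau <- perms) phi tau *
      \sum_(f <- words n (iota 0 D) | listing n R (prepend f S) == tau) v r ^+ sumn f =
    \sum_(tau <- perms) \sum_(f <- words n (iota 0 D))
      if listing n R (prepend f S) == tau then phi tau * v r ^+ sumn f else 0)%R.
    by apply: eq_bigr => tau _; rewrite mulr_sumr big_mkcond.
  rewrite exchange_big /= mulr_sumr; apply: eq_big_seq => f.
  rewrite mem_words => /andP[/eqP sf _].
  rewrite (prod_wvec_prepend _ vS sf).
  rewrite [X in _ = (_ * X)%R](bigD1_seq (listing n R (prepend f S))) //=; last first.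
    by rewrite /perms mem_permutations perm_listing.
  rewrite eqxx [X in _ = (_ * (_ + X))%R]big1 => [|tau]; last first.
    by rewrite eq_sym => /negPf ->.
  by rewrite addr0 [RHS]mulrC mulrA.
rewrite mulrCA [(phi' _ * _)%R]mulrC; apply: eqc_mull.
rewrite mulr_sumr; apply: eqc_sum => tau ht.
rewrite mulrCA -cmE //; apply: eqc_mull.
by apply: (listing_gf R _ vS); [exact: hv | rewrite -mem_permutations].
Qed.

(** * Standardization of semistandard tableaux *)

Definition cells (la : seq nat) : seq (nat * nat) :=
  [seq (r, c) | r <- iota 0 (size la), c <- iota 0 (nth 0 la r)].

Definition entry (X : Type) (x0 : X) (t : seq (seq X)) (rc : nat * nat) : X :=
  nth x0 (nth [::] t rc.1) rc.2.

Definition tabof (X : Type) (la : seq nat) (g : nat * nat -> X) : seq (seq X) :=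
  [seq [seq g (r, c) | c <- iota 0 (nth 0 la r)] | r <- iota 0 (size la)].

Lemma mem_cells la r c : ((r, c) \in cells la) = (r < size la) && (c < nth 0 la r).
Proof.
apply/allpairsPdep/andP => [[r' [c' []]]|[hr hc]].
  by rewrite !mem_iota !add0n => /andP[_ ?] /andP[_ ?] [-> ->].
by exists r, c; rewrite !mem_iota.
Qed.

Lemma cells_uniq la : uniq (cells la).
Proof.
apply: allpairs_uniq_dep; rewrite ?iota_uniq //.
  by move=> ? _; apply: iota_uniq.
by move=> [? ?] [? ?] _ _ /= [-> ->].
Qed.

Lemma flatten_tabof (X : Type) la (g : nat * nat -> X) :
  flatten (tabof la g) = map g (cells la).
Proof.
rewrite /tabof /cells map_flatten -map_comp; congr flatten; apply: eq_map => r /=.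
by rewrite -map_comp.
Qed.

Lemma shape_tabof (X : Type) la (g : nat * nat -> X) : Defs.shape (tabof la g) = la.
Proof.
rewrite /Defs.shape -map_comp; apply: (@eq_from_nth _ 0) => [|r].
  by rewrite size_map size_iota.
rewrite size_map size_iota => hr; rewrite (nth_map 0) ?size_iota // nth_iota //=.
by rewrite size_map size_iota.
Qed.

Lemma size_cells la : size (cells la) = sumn la.
Proof.
rewrite -(size_map (fun=> tt)) -flatten_tabof size_flatten; congr sumn.
exact: shape_tabof.
Qed.

Lemma entry_tabof (X : Type) (x0 : X) la (g : nat * nat -> X) rc :
  rc \in cells la -> entry x0 (tabof la g) rc = g rc.
Proof.
case: rc => r c; rewrite mem_cells => /andP[hr hc]; rewrite /entry /tabof /=.
by rewrite !(nth_map 0) ?size_iota ?nth_iota.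
Qed.

Lemma tabof_entry (X : Type) (x0 : X) (t : seq (seq X)) :
  tabof (Defs.shape t) (entry x0 t) = t.
Proof.
rewrite /tabof /Defs.shape size_map; apply: (@eq_from_nth _ [::]) => [|r].
  by rewrite size_map size_iota.
rewrite size_map size_iota => hr; rewrite (nth_map 0) ?size_iota // nth_iota //= add0n.
rewrite (nth_map [::]) //; apply: (@eq_from_nth _ x0) => [|c].
  by rewrite size_map size_iota.
rewrite size_map size_iota => hc.
by rewrite (nth_map 0) ?size_iota // nth_iota.
Qed.

Lemma eq_tabof (X : Type) la (g h : nat * nat -> X) :
  (forall rc, rc \in cells la -> g rc = h rc) -> tabof la g = tabof la h.
Proof.
move=> gh; apply/eq_in_map => r; rewrite mem_iota => hr.
apply/eq_in_map => c; rewrite mem_iota => hc; apply: gh; rewrite mem_cells.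
by lia.
Qed.

Lemma map_tabof (X Y : Type) (f : X -> Y) la (g : nat * nat -> X) :
  map (map f) (tabof la g) = tabof la (f \o g).
Proof. by rewrite /tabof -map_comp; apply: eq_map => r /=; rewrite -map_comp. Qed.

Lemma tab_condP (X : Type) (x0 : X) (rr cr : rel X) (t : seq (seq X)) :
  transitive rr ->
  reflect ((forall r c c', c < c' -> (r, c') \in cells (Defs.shape t) ->
              rr (entry x0 t (r, c)) (entry x0 t (r, c'))) /\
           (forall r c, (r.+1, c) \in cells (Defs.shape t) ->
              cr (entry x0 t (r, c)) (entry x0 t (r.+1, c))))
          (tab_cond x0 rr cr t).
Proof.
move=> tr; have mc r c : ((r, c) \in cells (Defs.shape t)) =
    (r < size t) && (c < size (nth [::] t r)).
  rewrite mem_cells size_map; case: ltnP => //= hr.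
  by rewrite (nth_map [::]).
apply: (iffP andP) => [[/all_nthP rows /allP cols]|[rows cols]]; split.
- move=> r c c' cc'; rewrite mc => /andP[hr hc'].
  apply: (sorted_ltn_nth tr x0 (rows [::] r hr)) => //.
  by apply: ltn_trans hc'.
- move=> r c; rewrite mc => /andP[hr hc].
  have /cols/allP : r \in iota 0 (size t).-1 by rewrite mem_iota; lia.
  by apply; rewrite mem_iota.
- apply/(all_nthP [::]) => r hr; apply/(sortedP x0) => c hc.
  by apply: (rows r c c.+1) => //; rewrite mc hr.
- apply/allP => r; rewrite mem_iota => hr; apply/allP => c; rewrite mem_iota => hc.
  by apply: cols; rewrite mc; lia.
Qed.

Definition cell_of (T : seq (seq nat)) (i : nat) : nat * nat :=
  (rowof T i, index i (nth [::] T (rowof T i))).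

Lemma cell_of_cells T i : i \in flatten T -> cell_of T i \in cells (Defs.shape T).
Proof.
move/flattenP => [row hrow irow]; have hs : has (fun r => i \in r) T.
  by apply/hasP; exists row.
rewrite mem_cells size_map /rowof -has_find hs /=.
rewrite (nth_map [::]); last by rewrite -has_find.
by rewrite index_mem; apply: (nth_find [::] hs).
Qed.

Lemma entry_cell_of T i : i \in flatten T -> entry 0 T (cell_of T i) = i.
Proof.
move/flattenP => [row hrow irow]; have hs : has (fun r => i \in r) T.
  by apply/hasP; exists row.
by rewrite /entry /= nth_index //; apply: (nth_find [::] hs).
Qed.

Lemma entry_inj T : uniq (flatten T) -> {in cells (Defs.shape T) &, injective (entry 0 T)}.
Proof.
rewrite -[in uniq _](tabof_entry 0 T) flatten_tabof => u x y xs ys /eqP xy.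
have sx := index_mem x (cells (Defs.shape T)); have sy := index_mem y (cells (Defs.shape T)).
move: xy; rewrite -(nth_index (0, 0) xs) -(nth_index (0, 0) ys).
rewrite -!(nth_map _ 0) ?sx ?sy // nth_uniq ?size_map ?sx ?sy //.
by move/eqP->.
Qed.

Lemma entry_mem (X : eqType) (x0 : X) T rc :
  rc \in cells (Defs.shape T) -> entry x0 T rc \in flatten T.
Proof.
by move=> h; rewrite -[flatten T](congr1 flatten (tabof_entry x0 T)) flatten_tabof map_f.
Qed.

Lemma cell_of_entry T rc : uniq (flatten T) -> rc \in cells (Defs.shape T) ->
  cell_of T (entry 0 T rc) = rc.
Proof.
move=> u h; have m := entry_mem 0 h.
by apply: (entry_inj u) => //; rewrite ?cell_of_cells ?entry_cell_of.
Qed.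

(** The standardization order. Equal entries are numbered from the lowest row upwards and from left
    to right inside a row; in a semistandard tableau they form a horizontal strip, which is thus
    read from left to right. *)
Definition cell_le (g : nat * nat -> seq nat) (x y : nat * nat) : bool :=
  lex_lt (g x) (g y) ||
  (g x == g y) && ((y.1 < x.1) || (x.1 == y.1) && (x.2 <= y.2)).

Lemma cell_le_trans g : transitive (cell_le g).
Proof.
move=> b a c; rewrite /cell_le.
case/orP=> [ab|/andP[/eqP-> h1]] /orP[bc|/andP[/eqP<- h2]].
- by rewrite (lex_lt_trans ab bc).
- by rewrite ab.
- by rewrite bc.
- by apply/orP; right; rewrite eqxx /=; lia.
Qed.

Lemma cell_le_anti g : antisymmetric (cell_le g).
Proof.
move=> [a1 a2] [b1 b2]; rewrite /cell_le => /andP[].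
case/orP=> [ab|/andP[/eqP-> h1]] /orP[bc|/andP[/eqP e h2]].
- by move: (lex_lt_trans ab bc); rewrite lex_lt_irr.
- by move: ab; rewrite e lex_lt_irr.
- by move: bc; rewrite lex_lt_irr.
- by congr pair; move: h1 h2 => /=; lia.
Qed.

Lemma cell_le_total g x y : size (g x) = size (g y) -> cell_le g x y || cell_le g y x.
Proof.
move=> /lex_lt_total; rewrite /cell_le => /or3P[->//|/eqP->|->]; last by rewrite !orbT.
by rewrite eqxx lex_lt_irr /=; lia.
Qed.

Definition cellsort (la : seq nat) (g : nat * nat -> seq nat) : seq (nat * nat) :=
  sort (cell_le g) (cells la).

Definition std (la : seq nat) (g : nat * nat -> seq nat) : seq (seq nat) :=
  tabof la (fun rc => (index rc (cellsort la g)).+1).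

Definition std_vals (la : seq nat) (g : nat * nat -> seq nat) : seq (seq nat) :=
  map g (cellsort la g).

Lemma sorted_iota1P (le : rel nat) n :
  reflect (forall i, 0 < i < n -> le i i.+1) (sorted le (iota 1 n)).
Proof.
apply: (iffP (sortedP 0)) => [H [|i] // /andP[_ i_n]|H i].
  by have := H i; rewrite size_iota !nth_iota ?add1n //; [apply|apply: ltnW].
rewrite size_iota => i_n; rewrite !nth_iota //; last exact: ltnW.
by apply: H; lia.
Qed.

Lemma mem_tdes n T i : 0 < i < n -> (i \in tdes n T) = (rowof T i < rowof T i.+1).
Proof. by move=> hi; rewrite mem_filter mem_iota; case: (_ < _) => //=; lia. Qed.

Lemma lex_le_trans : transitive lex_le.
Proof. exact: refl_closure_trans lex_lt_trans. Qed.

(** From [i] to [i.+1] the block number stays the same exactly when [i] is a descent of [T], and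
    then the order inside the block puts [i.+1] first. *)
Lemma leS_succ n T S i : 0 < i < n ->
  leS (tdes n T) S i i.+1 =
  lex_lt (sv S i) (sv S i.+1) ||
  ((sv S i == sv S i.+1) && (rowof T i.+1 <= rowof T i)).
Proof.
move=> hi; congr (_ || (_ && _)); rewrite -[in block _ i.+1](addn1 i) blockD /= addn0 mem_tdes //.
by rewrite -leqNgt; case: (_ <= rowof T i); rewrite /=; lia.
Qed.

(** Block numbers of distant labels say little about their rows. For neighbours, however, the
    comparison is one between rows, and that relation is transitive, so it propagates from [a] to
    [b]. *)
Lemma compat_labels n T S a b :
  sorted (leS (tdes n T) S) (iota 1 n) -> 0 < a -> a < b -> b <= n ->
  lex_lt (sv S a) (sv S b) || ((sv S a == sv S b) && (rowof T b <= rowof T a)).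
Proof.
move=> /sorted_iota1P st a0 ab bn.
pose key i j := lex_lt (sv S i) (sv S j) ||
  ((sv S i == sv S j) && (rowof T j <= rowof T i)).
have key_tr : transitive key.
  move=> y x z; rewrite /key.
  case/orP=> [xy|/andP[/eqP-> h1]] /orP[yz|/andP[/eqP<- h2]].
  - by rewrite (lex_lt_trans xy yz).
  - by rewrite xy.
  - by rewrite yz.
  - by rewrite eqxx (leq_trans h2 h1) orbT.
have srt : sorted key (iota 1 n).
  by apply/sorted_iota1P => i hi; have := st i hi; rewrite leS_succ.
have := sorted_ltn_nth key_tr 0 srt a.-1 b.-1.
rewrite !inE size_iota !nth_iota; try by lia.
have -> : 1 + a.-1 = a by lia.
have -> : 1 + b.-1 = b by lia.
by apply; lia.
Qed.

Lemma rowof_entry T rc : uniq (flatten T) -> rc \in cells (Defs.shape T) ->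
  rowof T (entry 0 T rc) = rc.1.
Proof. by move=> u h; rewrite -[LHS]/(cell_of T _).1 cell_of_entry. Qed.

Lemma is_sytP n la T : is_syt n la T ->
  [/\ Defs.shape T = la, perm_eq (flatten T) (iota 1 n), uniq (flatten T) &
      tab_cond 0 ltn ltn T].
Proof.
by case/and3P=> /eqP s p c; split => //; rewrite (perm_uniq p) iota_uniq.
Qed.

Lemma cells_up la r c : sorted geq la -> (r.+1, c) \in cells la -> (r, c) \in cells la.
Proof.
move=> /(sortedP 0) la_dec; rewrite !mem_cells => /andP[hr hc].
by rewrite (ltnW hr) (leq_trans hc (la_dec r hr)).
Qed.

(** Both conditions come from [compat_labels]. Down a column the labels increase while the row index
    also increases, which rules out the case of equal vectors and leaves a strict inequality. *)
Lemma unstd_ssyt n la T S : sorted geq la -> is_syt n la T ->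
  sorted (leS (tdes n T) S) (iota 1 n) ->
  is_ssyt la (map (map (sv S)) T).
Proof.
move=> la_dec /is_sytP[sT pT uT cT] cS; rewrite /is_ssyt.
have fT : flatten (map (map (sv S)) T) = map (sv S) (flatten T) by rewrite map_flatten.
have shE : Defs.shape (map (map (sv S)) T) = la.
  by rewrite -sT /Defs.shape -map_comp; apply: eq_map => r /=; rewrite size_map.
rewrite shE eqxx /=; have TE : T = tabof la (entry 0 T) by rewrite -sT tabof_entry.
have tE rc : rc \in cells la -> entry [::] (map (map (sv S)) T) rc = sv S (entry 0 T rc).
  by move=> h; rewrite [in LHS]TE map_tabof entry_tabof.
have bd rc : rc \in cells la -> 0 < entry 0 T rc <= n.
  by rewrite -sT => /(entry_mem 0); rewrite (perm_mem pT) mem_iota add1n ltnS.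
have /(tab_condP _ _ _ ltn_trans)[rows cols] := cT.
rewrite sT in rows cols.
apply/(tab_condP _ _ _ lex_le_trans); rewrite shE; split => [r c c' cc' h'|r c h'].
  have h : (r, c) \in cells la by move: h'; rewrite !mem_cells; lia.
  rewrite !tE //; have := rows _ _ _ cc' h' => /= lt.
  have := compat_labels (a := entry 0 T (r, c)) (b := entry 0 T (r, c')) cS.
  move/(_ _ lt); case/andP: (bd _ h) (bd _ h') => -> _ /andP[_ ->] /(_ isT isT).
  by rewrite /lex_le => /orP[->|/andP[-> _]]; rewrite ?orbT.
have h := cells_up la_dec h'; rewrite !tE //; have := cols _ _ h' => /= lt.
have := compat_labels (a := entry 0 T (r, c)) (b := entry 0 T (r.+1, c)) cS.
move/(_ _ lt); case/andP: (bd _ h) (bd _ h') => -> _ /andP[_ ->] /(_ isT isT).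
by rewrite !rowof_entry ?sT //= ltnn andbF orbF.
Qed.

Lemma perm_cellsort la g : perm_eq (cellsort la g) (cells la).
Proof. by rewrite perm_sort. Qed.

Lemma size_cellsort la g : size (cellsort la g) = sumn la.
Proof. by rewrite size_sort size_cells. Qed.

Lemma cellsort_uniq la g : uniq (cellsort la g).
Proof. by rewrite sort_uniq cells_uniq. Qed.

Lemma flatten_std la g : perm_eq (flatten (std la g)) (iota 1 (sumn la)).
Proof.
rewrite flatten_tabof.
have -> : iota 1 (sumn la) =
    [seq (index rc (cellsort la g)).+1 | rc <- cellsort la g].
  apply: (@eq_from_nth _ 0) => [|i]; rewrite ?size_map size_iota ?size_cellsort //.
  move=> hi; rewrite nth_iota // (nth_map (0, 0)) ?size_cellsort //.
  by rewrite index_uniq ?cellsort_uniq ?size_cellsort.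
by apply: perm_map; rewrite perm_sym perm_cellsort.
Qed.

Lemma cell_of_std la g i : i < sumn la ->
  cell_of (std la g) i.+1 = nth (0, 0) (cellsort la g) i.
Proof.
move=> hi; set rc := nth _ _ _.
have hrc : rc \in cells la.
  by rewrite -(perm_mem (perm_cellsort la g)) mem_nth ?size_cellsort.
have <- : entry 0 (std la g) rc = i.+1.
  by rewrite entry_tabof // index_uniq ?cellsort_uniq ?size_cellsort.
apply: cell_of_entry; last by rewrite shape_tabof.
by rewrite (perm_uniq (flatten_std la g)) iota_uniq.
Qed.

Lemma cellsort_sorted la g k :
  (forall rc, rc \in cells la -> size (g rc) = k) -> sorted (cell_le g) (cellsort la g).
Proof.
move=> gk; apply: (@sort_sorted_in _ (mem (cells la))); last exact/allP.
by move=> x y hx hy; apply: cell_le_total; rewrite !gk.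
Qed.

(** Ranks increase along rows, where ties are broken by the column, and down columns, where the
    entries already increase strictly. *)
Lemma std_is_syt la g k : sorted geq la ->
  (forall rc, rc \in cells la -> size (g rc) = k) ->
  is_ssyt la (tabof la g) ->
  is_syt (sumn la) la (std la g).
Proof.
move=> la_dec gk /andP[_ /(tab_condP _ _ _ lex_le_trans)]; rewrite shape_tabof.
move=> [rows cols]; rewrite /is_syt shape_tabof eqxx flatten_std /=.
have lt_idx x y : x \in cells la -> y \in cells la -> cell_le g x y -> x != y ->
    (index x (cellsort la g)).+1 < (index y (cellsort la g)).+1.
  rewrite -!(perm_mem (perm_cellsort la g)) => hx hy xy nxy.
  rewrite ltnS ltn_neqAle (index_sorted (@cell_le_trans g) (@cell_le_anti g)) //; last first.
    exact: cellsort_sorted gk.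
  rewrite andbT; apply: contra nxy => /eqP e.
  by rewrite -(nth_index (0, 0) hx) e nth_index.
apply/(tab_condP _ _ _ ltn_trans); rewrite shape_tabof; split=> [r c c' cc' h'|r c h'].
  have h : (r, c) \in cells la by move: h'; rewrite !mem_cells; lia.
  rewrite !entry_tabof //; apply: lt_idx => //.
    have := rows _ _ _ cc' h'; rewrite !entry_tabof // /cell_le /lex_le /=.
    by case/orP=> ->; rewrite ?eqxx ?(ltnW cc') ?orbT.
  by rewrite xpair_eqE eqxx /= neq_ltn cc'.
have h := cells_up la_dec h'.
rewrite !entry_tabof //; apply: lt_idx => //.
  by have := cols _ _ h'; rewrite !entry_tabof // /cell_le => ->.
by rewrite xpair_eqE negb_and neq_ltn ltnSn.
Qed.

Lemma sv_std_vals la g i : i < sumn la ->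
  sv (std_vals la g) i.+1 = g (nth (0, 0) (cellsort la g) i).
Proof. by move=> hi; rewrite /sv /std_vals (nth_map (0, 0)) ?size_cellsort. Qed.

(** Consecutive cells with equal entries never go to a strictly lower row in the order [cell_le], so
    no descent of the standardization occurs at a tie. *)
Lemma std_compat la g k :
  (forall rc, rc \in cells la -> size (g rc) = k) ->
  sorted (leS (tdes (sumn la) (std la g)) (std_vals la g)) (iota 1 (sumn la)).
Proof.
move=> gk; apply/sorted_iota1P => -[//|i] hi; rewrite leS_succ //.
rewrite !sv_std_vals ?(ltnW hi) //.
have rE j : j < sumn la -> rowof (std la g) j.+1 = (nth (0, 0) (cellsort la g) j).1.
  by move=> hj; rewrite -cell_of_std.
rewrite !rE ?(ltnW hi) //.
have := cellsort_sorted gk => /(sortedP (0, 0)) /(_ i); rewrite size_cellsort.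
move/(_ hi); rewrite /cell_le => /orP[->//|/andP[-> h]]; apply/orP; right => /=.
by lia.
Qed.

Lemma stdK la g : map (map (sv (std_vals la g))) (std la g) = tabof la g.
Proof.
rewrite map_tabof; apply: eq_tabof => rc; rewrite -(perm_mem (perm_cellsort la g)) => h /=.
by rewrite sv_std_vals ?nth_index // -(size_cellsort la g) index_mem.
Qed.

(** It suffices that the cells of [T], taken in the order of their labels, are sorted for [cell_le]:
    uniqueness of sorted lists then identifies them with [cellsort], which gives back both the
    labels and the vectors. *)
Lemma unstdK n k la T S : sumn la = n -> is_syt n la T -> vecs n k S ->
  sorted (leS (tdes n T) S) (iota 1 n) ->
  let g := entry [::] (map (map (sv S)) T) in
  std la g = T /\ std_vals la g = S.
Proof.
move=> la_n /is_sytP[sT pT uT cT] vS /sorted_iota1P cS' g.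
have /andP[/eqP sS _] := vS.
have TE : T = tabof la (entry 0 T) by rewrite -sT tabof_entry.
have gE rc : rc \in cells la -> g rc = sv S (entry 0 T rc).
  by move=> h; rewrite /g [in LHS]TE map_tabof entry_tabof.
have memT i : i \in iota 1 n -> i \in flatten T by rewrite (perm_mem pT).
have labK i : i \in iota 1 n -> entry 0 T (cell_of T i) = i by move/memT/entry_cell_of.
have labc i : i \in iota 1 n -> cell_of T i \in cells la by move/memT/cell_of_cells; rewrite sT.
have csE : cellsort la g = [seq cell_of T i | i <- iota 1 n].
  apply: (sorted_eq (@cell_le_trans g) (@cell_le_anti g)).
  - apply: (@cellsort_sorted _ _ k) => rc hrc; rewrite gE //; apply: (@size_sv n) => //.
    by rewrite -(perm_mem pT) entry_mem ?sT.
  - have su : sorted (fun i j => cell_le g (cell_of T i) (cell_of T j)) (iota 1 n).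
      apply/sorted_iota1P => i hi.
      have m1 : i \in iota 1 n by rewrite mem_iota; lia.
      have m2 : i.+1 \in iota 1 n by rewrite mem_iota; lia.
      have := cS' i hi; rewrite leS_succ // /cell_le !gE ?labc // !labK //.
      case/orP => [->//|/andP[-> hr]]; apply/orP; right.
      have {hr} : (cell_of T i.+1).1 <= (cell_of T i).1 by [].
      move: (labc _ m1) (labK _ m1) (labK _ m2).
      case: (cell_of T i) => r c; case: (cell_of T i.+1) => r' c' /= h k1 k2.
      (* For labels [i] and [i.+1] in the same row, the columns are in the right order because [T]
         increases along its rows. *)
      rewrite leq_eqVlt => /orP[/eqP rE|->//]; apply/orP; right.
      rewrite rE eqxx /= leqNgt; apply/negP => lt.
      have /(tab_condP _ _ _ ltn_trans)[rows _] := cT.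
      have := rows r _ _ lt; rewrite sT h -{1}rE k1 k2 => /(_ isT) /=.
      by rewrite ltnNge leqnSn.
    by rewrite sorted_map.
  - apply: (perm_trans (perm_cellsort la g)); apply: uniq_perm.
    + exact: cells_uniq.
    + by rewrite map_inj_in_uniq ?iota_uniq // => i j hi hj e; rewrite -(labK i) // e labK.
    + move=> rc; apply/idP/mapP => [h|[i hi ->]]; last exact: labc.
      exists (entry 0 T rc); last by rewrite cell_of_entry ?sT.
      by rewrite -(perm_mem pT) entry_mem ?sT.
split.
  rewrite [RHS]TE; apply: eq_tabof => rc h.
  have it : entry 0 T rc \in iota 1 n by rewrite -(perm_mem pT) entry_mem ?sT.
  have -> : rc = cell_of T (entry 0 T rc) by rewrite cell_of_entry ?sT.
  rewrite csE labK //; move: it; move: (entry 0 T rc) => i; rewrite mem_iota => hi.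
  have -> : cell_of T i = nth (0, 0) [seq cell_of T j | j <- iota 1 n] i.-1.
    rewrite (nth_map 0) ?size_iota ?nth_iota; try by lia.
    by congr cell_of; lia.
  by rewrite index_uniq -?csE ?cellsort_uniq ?size_cellsort; lia.
rewrite /std_vals csE -map_comp -[RHS](map_nth_pred [::] sS).
by apply/eq_in_map => i hi /=; rewrite gE ?labc // labK.
Qed.

(** * Enumeration of tableaux by their reading words *)

Lemma mem_reshape_words (X : eqType) la (L : seq (seq X)) (t : seq (seq X)) :
  all (fun w => size w == sumn la) L ->
  (t \in [seq reshape la w | w <- L]) = (Defs.shape t == la) && (flatten t \in L).
Proof.
move=> /allP sL; apply/mapP/andP => [[w wL ->]|[/eqP sh fL]].
  have /eqP sw := sL w wL.
  split; first by apply/eqP; apply: reshapeKl; rewrite sw.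
  by rewrite reshapeKr ?sw.
by exists (flatten t) => //; rewrite -sh; apply/esym/flattenK.
Qed.

Lemma reshape_uniq (X : eqType) la (L : seq (seq X)) :
  all (fun w => size w == sumn la) L -> uniq L -> uniq [seq reshape la w | w <- L].
Proof.
move=> /allP sL uL; rewrite map_inj_in_uniq // => w w' /sL/eqP sw /sL/eqP sw' E.
by rewrite -[w](@reshapeKr _ la) ?sw // E reshapeKr ?sw'.
Qed.

Lemma mem_syts n la T : sumn la = n -> (T \in syts n la) = is_syt n la T.
Proof.
move=> la_n; rewrite mem_filter mem_reshape_words; last first.
  by apply/allP => w; rewrite mem_permutations => /perm_size ->; rewrite size_iota la_n.
by rewrite mem_permutations /is_syt; case: eqP => //=; case: perm_eq; rewrite /= ?andbT ?andbF.
Qed.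

Lemma syts_uniq n la : sumn la = n -> uniq (syts n la).
Proof.
move=> la_n; rewrite filter_uniq // reshape_uniq ?permutations_uniq //.
by apply/allP => w; rewrite mem_permutations => /perm_size ->; rewrite size_iota la_n.
Qed.

Definition tableaux (X : eqType) (x0 : X) (le lt : rel X) (la : seq nat) (al : seq X) :
    seq (seq (seq X)) :=
  [seq t <- [seq reshape la w | w <- words (sumn la) al] | tab_cond x0 le lt t].

Lemma mem_tableaux (X : eqType) (x0 : X) le lt la al t :
  (t \in tableaux x0 le lt la al) =
  [&& Defs.shape t == la, all (mem al) (flatten t) & tab_cond x0 le lt t].
Proof.
rewrite mem_filter mem_reshape_words; last first.
  by apply/allP => w; rewrite mem_words => /andP[].
rewrite mem_words andbC -andbA; case: (Defs.shape t =P la) => //= <-.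
by rewrite size_flatten eqxx.
Qed.

Lemma tableaux_uniq (X : eqType) (x0 : X) le lt la al :
  uniq al -> uniq (tableaux x0 le lt la al).
Proof.
move=> ual; rewrite filter_uniq // reshape_uniq ?words_uniq //.
by apply/allP => w; rewrite mem_words => /andP[].
Qed.

(** A semistandard tableau corresponds to its standardization [T] together with the list [S] of its
    entries in the order of the labels; the compatible [S] are those for which the identity sorts
    [leS (tdes n T) S]. *)
Lemma sum_standardize (A : nmodType) n k D la (F : seq (seq (seq nat)) -> A) :
  sorted geq la -> sumn la = n ->
  (\sum_(t <- tableaux [::] lex_le lex_lt la (words k (iota 0 D))) F t =
   \sum_(T <- syts n la)
     \sum_(S <- words n (words k (iota 0 D)) | sorted (leS (tdes n T) S) (iota 1 n))
       F (map (map (sv S)) T))%R.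
Proof.
move=> la_dec la_n; set al := words k (iota 0 D).
have ual : uniq al by rewrite words_uniq ?iota_uniq.
pose L := [seq TS <- [seq (T, S0) | T <- syts n la, S0 <- words n al] |
  sorted (leS (tdes n TS.1) TS.2) (iota 1 n)].
have mL T S0 : ((T, S0) \in L) = [&& is_syt n la T, S0 \in words n al &
    sorted (leS (tdes n T) S0) (iota 1 n)].
  rewrite mem_filter /= andbC -mem_syts // andbA; congr andb.
  by apply/allpairsP/andP => [[[? ?] /= [? ? [-> ->]]]|[? ?]] //; exists (T, S0).
transitivity (\sum_(TS <- L) F (map (map (sv TS.2)) TS.1))%R; last first.
  rewrite big_filter big_mkcond big_allpairs_dep /=; apply: eq_bigr => T _.
  by rewrite [RHS]big_mkcond.
have tE t : t \in tableaux [::] lex_le lex_lt la al ->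
  [/\ tabof la (entry [::] t) = t, is_ssyt la (tabof la (entry [::] t)) &
      forall rc, rc \in cells la -> entry [::] t rc \in al].
  rewrite mem_tableaux => /and3P[/eqP sh /allP al_t tc].
  have tE : tabof la (entry [::] t) = t by rewrite -sh tabof_entry.
  rewrite /is_ssyt tE sh eqxx tc; split=> // rc; rewrite -sh => /(entry_mem [::]).
  exact: al_t.
have sz t : t \in tableaux [::] lex_le lex_lt la al ->
    forall rc, rc \in cells la -> size (entry [::] t rc) = k.
  by case/tE=> _ _ h rc /h; rewrite mem_words => /andP[/eqP].
apply: (big_bij_seq (h := fun t => (std la (entry [::] t), std_vals la (entry [::] t)))
   (g := fun TS => map (map (sv TS.2)) TS.1)).
- exact: tableaux_uniq.
- rewrite filter_uniq // allpairs_uniq ?syts_uniq ?words_uniq ?iota_uniq //.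
  by move=> [? ?] [? ?].
- move=> t ht; have [_ ss hal] := tE t ht.
  rewrite mL -la_n (std_is_syt la_dec (sz t ht)) // (std_compat (sz t ht)) andbT /=.
  rewrite mem_words size_map size_cellsort eqxx /= all_map; apply/allP => rc.
  by rewrite (perm_mem (perm_cellsort _ _)) => /hal.
- move=> [T S0]; rewrite mL /= => /and3P[hT hS cS].
  have := unstd_ssyt la_dec hT cS; rewrite mem_tableaux => /andP[-> ->]; rewrite andbT /=.
  have /is_sytP[sT pT _ _] := hT; rewrite -map_flatten all_map; apply/allP => i.
  rewrite (perm_mem pT) mem_iota => hi; move: hS; rewrite mem_words => /andP[/eqP sS /allP].
  by apply; apply: mem_nth; lia.
- by move=> t /tE[tt _ _]; rewrite /= stdK tt.
- move=> [T S0]; rewrite mL /= => /and3P[hT hS cS].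
  by have [-> ->] := unstdK la_n hT (vecs_words hS) cS.
- by move=> t /tE[tt _ _]; rewrite /= stdK tt.
Qed.

(** * Symmetry of Schur polynomials *)

(** The shapes left after removing a horizontal strip, given by interlacing. Trailing zeros are kept
    so that all have the length of [la]; the default 0 of [nth] supplies the lower bound of the last
    part. *)
Definition strips (la : seq nat) : seq (seq nat) :=
  [seq mu <- words (size la) (iota 0 (sumn la).+1) |
     all (fun i => nth 0 la i.+1 <= nth 0 mu i <= nth 0 la i) (iota 0 (size la))].

Lemma sumn_nth s : sumn s = \sum_(i < size s) nth 0 s i.
Proof. by rewrite sumnE (big_nth 0) big_mkord. Qed.

Lemma leq_nth_sumn s i : nth 0 s i <= sumn s.
Proof.
elim: s i => [|x s IH] [|i] //=; first exact: leq_addr.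
exact: leq_trans (IH i) (leq_addl _ _).
Qed.

Lemma stripsP la mu :
  reflect (size mu = size la /\
           forall i, i < size la -> nth 0 la i.+1 <= nth 0 mu i <= nth 0 la i)
          (mu \in strips la).
Proof.
rewrite mem_filter mem_words; apply: (iffP idP) => [/and3P[/allP H /eqP sm _]|[sm H]].
  by split=> // i hi; apply: H; rewrite mem_iota.
apply/and3P; split; rewrite ?sm //.
  by apply/allP => i; rewrite mem_iota => hi; apply: H.
apply/(all_nthP 0) => i; rewrite sm => /H /andP[_ h]; rewrite [mem _ _]mem_iota add0n ltnS.
exact: leq_trans h (leq_nth_sumn _ _).
Qed.

Lemma strips_uniq la : uniq (strips la).
Proof. by rewrite filter_uniq // words_uniq ?iota_uniq. Qed.

Lemma strips_sorted la mu : sorted geq la -> mu \in strips la -> sorted geq mu.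
Proof.
move=> la_dec /stripsP[sm H]; apply/(sortedP 0) => i; rewrite sm => hi.
have /andP[h1 _] := H i (ltnW hi); have /andP[_ h2] := H _ hi.
by apply: leq_trans h2 h1.
Qed.

Lemma strips_leq la mu : mu \in strips la -> sumn mu <= sumn la.
Proof.
move=> /stripsP[sm H]; rewrite !sumn_nth sm; apply: leq_sum => i _.
by case/andP: (H i (ltn_ord i)).
Qed.

(** The branching rule for Schur polynomials: [x] belongs to the largest letter, whose cells form a
    horizontal strip, and its exponent is the size of that strip. *)
Fixpoint schur_rec (A : comPzRingType) (xs : seq A) (la : seq nat) : A :=
  if xs is x :: xs' then
    (\sum_(mu <- strips la) x ^+ (sumn la - sumn mu) * schur_rec xs' mu)%R
  else ((sumn la == 0)%:R)%R.

(* Bender-Knuth on Gelfand-Tsetlin patterns: for fixed [nu] and [la], each     *)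
(* [mu_i] ranges over an interval independently of the others; [mu_refl]       *)
(* reverses every one of these intervals.                                      *)
Definition mu_refl (la nu mu : seq nat) : seq nat :=
  mkseq (fun i => maxn (nth 0 nu i) (nth 0 la i.+1) +
    (if i is j.+1 then minn (nth 0 la i) (nth 0 nu j) else nth 0 la 0) - nth 0 mu i)
    (size la).

(** Interlacing with both [la] and [nu] means [lo i <= mu_i <= hi i] for each [i], so reversing
    these intervals is an involution. The sum of all endpoints is computed by telescoping. *)
Lemma mu_refl_strips la nu mu : mu \in strips la -> nu \in strips mu ->
  [/\ mu_refl la nu mu \in strips la, nu \in strips (mu_refl la nu mu),
      mu_refl la nu (mu_refl la nu mu) = mu &
      sumn mu + sumn (mu_refl la nu mu) = sumn la + sumn nu].
Proof.
move=> /stripsP[sm hm] /stripsP[sn hn]; rewrite sm in sn hn.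
set m := size la in sm sn hm hn *.
pose lo i := maxn (nth 0 nu i) (nth 0 la i.+1).
pose hi i := if i is j.+1 then minn (nth 0 la i) (nth 0 nu j) else nth 0 la 0.
have srf mu' : size (mu_refl la nu mu') = m by rewrite size_mkseq.
have rf mu' i : i < m -> nth 0 (mu_refl la nu mu') i = lo i + hi i - nth 0 mu' i.
  by move=> im; rewrite nth_mkseq.
have bd i : i < m -> lo i <= nth 0 mu i <= hi i.
  move=> im; have := hm i im; have := hn i im; rewrite /lo /hi; case: i im => [|j] jm.
    by lia.
  by have := hn j (ltnW jm); lia.
have hihi i : hi i <= nth 0 la i by rewrite /hi; case: i => //= j; lia.
split.
- apply/stripsP; split=> // i im; rewrite rf //; have := bd i im; have := hihi i.
  by rewrite /lo; lia.
- apply/stripsP; rewrite srf; split=> // i im; rewrite [nth 0 (mu_refl _ _ _) i]rf //.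
  apply/andP; split; last by have := bd i im; rewrite /lo; lia.
  case: (ltnP i.+1 m) => im'; last by rewrite nth_default ?srf.
  by rewrite rf //; have := bd _ im'; rewrite /hi; lia.
- apply: (@eq_from_nth _ 0); rewrite srf ?sm // => i im.
  by rewrite !rf //; have := bd i im; lia.
rewrite !sumn_nth srf sm sn -/m -!big_split /=.
have -> : \sum_(i < m) (nth 0 mu i + nth 0 (mu_refl la nu mu) i) =
          \sum_(i < m) (lo i + hi i).
  by apply: eq_bigr => i _; rewrite rf //; have := bd i (ltn_ord i); lia.
(* The terms [lo j] and [hi j.+1] are the maximum and the minimum of the same two numbers, so they
   add up to [nu_j + la_(j+1)]. *)
have tele j : \sum_(i < j) (lo i + hi i) + hi j =
              \sum_(i < j) (nth 0 la i + nth 0 nu i) + nth 0 la j.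
  elim: j => [|j IH]; first by rewrite !big_ord0.
  by move: IH; rewrite !big_ord_recr /= /lo; lia.
move: (tele m); rewrite (nth_default 0 (s := la)) //.
case E: m => [|j]; first by rewrite !big_ord0.
have -> : hi j.+1 = 0 by rewrite /hi (nth_default 0 (s := la)) ?min0n -?E.
by rewrite !addn0.
Qed.

(** Since |mu| + |mu'| = |la| + |nu|, replacing [mu] by its reflection [mu'] exchanges the exponents
    of [x] and [y]. *)
Lemma schur_rec_swap (A : comPzRingType) (x y : A) xs la :
  schur_rec (x :: y :: xs) la = schur_rec (y :: x :: xs) la.
Proof.
rewrite /=; pose L := [seq (mu, nu) | mu <- strips la, nu <- strips mu].
have uL : uniq L.
  apply: allpairs_uniq_dep; first exact: strips_uniq.
    by move=> mu _; apply: strips_uniq.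
  by move=> [? ?] [? ?] _ _ /= [-> ->].
have mL mu nu : ((mu, nu) \in L) = (mu \in strips la) && (nu \in strips mu).
  apply/allpairsPdep/andP => [[? [? [? ? [-> ->]]]] //|[? ?]].
  by exists mu, nu.
pose F (x y : A) p :=
  (x ^+ (sumn la - sumn p.1) * (y ^+ (sumn p.1 - sumn p.2) * schur_rec xs p.2))%R.
have LE (x' y' : A) : (\sum_(mu <- strips la) x' ^+ (sumn la - sumn mu) *
     (\sum_(nu <- strips mu) y' ^+ (sumn mu - sumn nu) * schur_rec xs nu) =
   \sum_(p <- L) F x' y' p)%R.
  rewrite big_allpairs_dep; apply: eq_bigr => mu _; rewrite mulr_sumr.
  by apply: eq_bigr.
rewrite !LE; pose h p := (mu_refl la p.2 p.1, p.2) : seq nat * seq nat.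
have hL : {in L, forall p, h p \in L}.
  by move=> [mu nu]; rewrite !mL => /andP[a b]; case: (mu_refl_strips a b) => -> ->.
have hK : {in L, cancel h h}.
  by move=> [mu nu]; rewrite !mL => /andP[a b]; rewrite /h /=;
     case: (mu_refl_strips a b) => _ _ ->.
apply: (big_bij_seq (h := h) (g := h)) => // -[mu nu]; rewrite mL => /andP[a b].
have [a' b' _ E] := mu_refl_strips a b.
move: (strips_leq a) (strips_leq b) (strips_leq a') (strips_leq b') => h1 h2 h3 h4.
rewrite /F /=.
have -> : sumn la - sumn (mu_refl la nu mu) = sumn mu - sumn nu by lia.
have -> : sumn (mu_refl la nu mu) - sumn nu = sumn la - sumn mu by lia.
by rewrite mulrCA.
Qed.

(** Adjacent swaps bring any chosen letter to the front; induction handles the rest. *)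
Lemma schur_rec_perm (A : comPzRingType) (xs ys : seq A) la :
  perm_eq xs ys -> schur_rec xs la = schur_rec ys la.
Proof.
have front (x : A) (zs : seq A) :
    x \in zs -> forall la, schur_rec zs la = schur_rec (x :: rem x zs) la.
  elim: zs => //= z zs IH; rewrite inE eq_sym; case: eqP => [->//|_] /= xz {}la.
  transitivity (schur_rec (z :: x :: rem x zs) la); last exact: schur_rec_swap.
  by apply: eq_bigr => mu _; rewrite (IH xz).
elim: ys xs la => [|y ys IH] xs la; first by move=> /perm_nilP ->.
move=> p; have yx : y \in xs by rewrite (perm_mem p) mem_head.
rewrite (front y) //; apply: eq_bigr => mu _; congr (_ * _)%R; apply: IH.
by rewrite -(perm_cons y); apply: perm_trans p; rewrite perm_sym perm_to_rem.
Qed.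

(** * Removal of the largest letter from a tableau *)

Lemma decreasing_pred (X : Type) (x0 : X) (p : pred X) (s : seq X) :
  (forall i j, i < j -> j < size s -> p (nth x0 s j) -> p (nth x0 s i)) ->
  filter p s = take (count p s) s /\
  forall c, c < size s -> p (nth x0 s c) = (c < count p s).
Proof.
elim: s => [|a s IH] H //=.
have [|ft ct] := IH; first by move=> i j ij js; apply: (H i.+1 j.+1).
case pa: (p a) => /=; first by rewrite ft; split=> // -[|c] hc //=; rewrite ct.
have np : ~~ has p s.
  by apply/negP => /(has_nthP x0)[i hi pi]; have := H 0 i.+1 isT hi pi; rewrite /= pa.
have c0 : count p s = 0 by apply/eqP; rewrite -leqn0 leqNgt -has_count.
have f0 : filter p s = [::] by apply: size0nil; rewrite size_filter.
rewrite c0 f0; split=> // -[|c] hc /=; first by rewrite pa.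
by apply/negbTE; apply: contra np => pc; apply/(has_nthP x0); exists c.
Qed.

Definition strip_off (X : eqType) (z : X) (t : seq (seq X)) : seq (seq X) :=
  map (filter (predC1 z)) t.

(** The inverse of [strip_off]: the cells of [la] outside the shape of [t] are filled with [z]. *)
Definition pad (X : eqType) (x0 z : X) (la : seq nat) (t : seq (seq X)) : seq (seq X) :=
  tabof la (fun rc => if rc.2 < nth 0 (Defs.shape t) rc.1 then entry x0 t rc else z).

Section RemoveLargest.
Variables (X : eqType) (x0 z : X) (lt : rel X) (al : seq X) (la : seq nat).
Hypotheses (lt_irr : irreflexive lt) (lt_trans : transitive lt).
Hypothesis (al_z : forall a, a \in al -> lt a z).
Hypothesis (la_dec : sorted geq la).

Let le a b := (a == b) || lt a b.

Let le_trans : transitive le := refl_closure_trans lt_trans.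

Lemma not_lt_largest a : a \in rcons al z -> lt z a = false.
Proof.
rewrite mem_rcons inE => /orP[/eqP->//|/al_z az].
by apply/negP => za; have := lt_trans az za; rewrite lt_irr.
Qed.

(** In each row the letters [z] come last, so the other entries form a prefix. Nothing can stand
    below a [z], because columns increase strictly; this gives the interlacing. *)
Lemma tableaux_rcons t : t \in tableaux x0 le lt la (rcons al z) ->
  [/\ Defs.shape (strip_off z t) \in strips la,
      strip_off z t = tabof (Defs.shape (strip_off z t)) (entry x0 t) &
      forall rc, rc \in cells la ->
        (entry x0 t rc != z) = (rc.2 < nth 0 (Defs.shape (strip_off z t)) rc.1)].
Proof.
rewrite mem_tableaux => /and3P[/eqP sh /allP ent /(tab_condP _ _ _ le_trans)].
rewrite sh => -[rows cols].
have ent' rc : rc \in cells la -> entry x0 t rc \in rcons al z.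
  by rewrite -sh => /(entry_mem x0)/ent.
have sz : size t = size la by rewrite -sh size_map.
have szr r : r < size la -> size (nth [::] t r) = nth 0 la r.
  by move=> hr; rewrite -sh (nth_map [::]) ?sz.
have dp r : r < size la ->
    filter (predC1 z) (nth [::] t r) =
      take (count (predC1 z) (nth [::] t r)) (nth [::] t r) /\
    forall c, c < nth 0 la r ->
      (entry x0 t (r, c) != z) = (c < count (predC1 z) (nth [::] t r)).
  move=> hr; rewrite -szr //; apply: (decreasing_pred (x0 := x0)) => i j ij.
  rewrite szr //= => hj; have hc : (r, j) \in cells la by rewrite mem_cells hr.
  have hc' : (r, i) \in cells la by rewrite mem_cells hr (ltn_trans ij).
  have := rows _ _ _ ij hc; rewrite /entry /= => le_ij.
  apply: contra => /eqP iz; move: le_ij; rewrite iz /le eq_sym => /orP[//|].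
  by rewrite not_lt_largest // (ent' _ hc).
have shE r : r < size la ->
    nth 0 (Defs.shape (strip_off z t)) r = count (predC1 z) (nth [::] t r).
  by move=> hr; rewrite /Defs.shape /strip_off -map_comp (nth_map [::]) ?sz //= size_filter.
split.
- apply/stripsP; rewrite !size_map sz; split=> // r hr; rewrite shE //.
  rewrite -(szr _ hr) count_size andbT.
  (* The last cell of row [r.+1] lies in column [c]; the entry above it is not [z], so the prefix of
     row [r] extends beyond column [c]. *)
  case E: (nth 0 la r.+1) => [|c] //.
  have hc : (r.+1, c) \in cells la.
    rewrite mem_cells E ltnSn andbT ltnNge; apply/negP => h.
    by move: E; rewrite nth_default.
  have := cells_up la_dec hc; rewrite mem_cells => /andP[_ hc'].
  have [_ <- //] := dp r hr; apply/negP => /eqP tz.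
  by have := cols _ _ hc; rewrite tz not_lt_largest // ent'.
- apply: (@eq_from_nth _ [::]) => [|r]; rewrite !size_map ?size_iota ?size_map // sz => hr.
  rewrite (nth_map 0) ?size_iota ?size_map ?sz // nth_iota ?size_map ?sz // add0n.
  rewrite (nth_map [::]) ?sz //; have [-> _] := dp r hr; rewrite shE //.
  apply: (@eq_from_nth _ x0) => [|c];
    rewrite size_takel ?count_size // ?size_map ?size_iota // => hc.
  by rewrite nth_take // (nth_map 0) ?size_iota // nth_iota.
- move=> [r c]; rewrite mem_cells => /andP[hr hc] /=; rewrite shE //.
  by have [_ ->] := dp r hr.
Qed.

Lemma strip_off_tableaux t : t \in tableaux x0 le lt la (rcons al z) ->
  strip_off z t \in tableaux x0 le lt (Defs.shape (strip_off z t)) al.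
Proof.
move=> ht; have [st tE ez] := tableaux_rcons ht.
move: ht; rewrite !mem_tableaux eqxx => /and3P[/eqP sh /allP ent].
move=> /(tab_condP _ _ _ le_trans); rewrite sh => -[rows cols] /=.
apply/andP; split.
  apply/allP => a; rewrite -filter_flatten mem_filter /= => /andP[az ha].
  have : a \in rcons al z by apply: ent.
  by rewrite mem_rcons inE (negPf az).
have sub rc : rc \in cells (Defs.shape (strip_off z t)) -> rc \in cells la.
  case: rc => r c; have /stripsP[sm hm] := st; rewrite !mem_cells sm => /andP[hr hc].
  by have /andP[_ h] := hm r hr; rewrite hr (leq_trans hc h).
have dec := strips_sorted la_dec st.
rewrite tE; apply/(tab_condP _ _ _ le_trans); rewrite shape_tabof.
split=> [r c c' cc' h'|r c h'].
  have h : (r, c) \in cells (Defs.shape (strip_off z t)).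
    by move: h'; rewrite !mem_cells; lia.
  by rewrite !entry_tabof //; apply: rows => //; apply: sub.
have h := cells_up dec h'.
by rewrite !entry_tabof //; apply: cols; apply: sub.
Qed.

Lemma pad_strip_off t : t \in tableaux x0 le lt la (rcons al z) ->
  pad x0 z la (strip_off z t) = t.
Proof.
move=> ht; have [st tE ez] := tableaux_rcons ht.
move: ht; rewrite mem_tableaux => /andP[/eqP sh _].
rewrite -[RHS](tabof_entry x0) sh; apply: eq_tabof => -[r c] h /=.
rewrite -(ez _ h); case: eqP => [-> //|nz]; rewrite [in LHS]tE entry_tabof //.
move: h; rewrite !mem_cells => /andP[hr hc]; have /stripsP[-> _] := st.
by rewrite hr /= -(ez (r, c)) ?mem_cells ?hr //; apply/eqP.
Qed.

Lemma pad_tableaux mu t : mu \in strips la -> t \in tableaux x0 le lt mu al ->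
  pad x0 z la t \in tableaux x0 le lt la (rcons al z).
Proof.
move=> /stripsP[sm hm]; rewrite !mem_tableaux => /and3P[/eqP sh /allP ent].
move=> /(tab_condP _ _ _ le_trans); rewrite sh => -[rows cols].
rewrite shape_tabof eqxx /=.
have ent' rc : rc \in cells mu -> entry x0 t rc \in al.
  by rewrite -sh => /(entry_mem x0)/ent.
apply/andP; split.
  apply/allP => a; rewrite flatten_tabof => /mapP[[r c] h ->] /=; rewrite sh mem_rcons inE.
  case: ifP => hc; last by rewrite eqxx.
  move: h; rewrite mem_cells => /andP[hr _].
  by rewrite ent' ?orbT // mem_cells sm hr.
apply/(tab_condP _ _ _ le_trans); rewrite shape_tabof; split=> [r c c' cc' h'|r c h'].
  have h : (r, c) \in cells la by move: h'; rewrite !mem_cells; lia.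
  rewrite !entry_tabof //= sh; move: h'; rewrite mem_cells => /andP[hr _].
  case: (ltnP c' (nth 0 mu r)) => hc'.
    by rewrite (ltn_trans cc' hc'); apply: rows => //; rewrite mem_cells sm hr.
  case: ltnP => hc; last by rewrite /le eqxx.
  by rewrite /le al_z ?orbT // ent' // mem_cells sm hr.
have h := cells_up la_dec h'; rewrite !entry_tabof //= sh.
move: h'; rewrite mem_cells => /andP[hr hc].
have hr' := ltnW hr; have /andP[h1 _] := hm r hr'.
(* By interlacing, the cell above any cell of row [r.+1] belongs to [mu], so it never holds [z]. *)
have hc' := leq_trans hc h1; rewrite hc'.
case: ltnP => hc2; first by apply: cols; rewrite mem_cells sm hr.
by apply/al_z/ent'; rewrite mem_cells sm hr'.
Qed.

Lemma strip_off_pad mu t : mu \in strips la -> t \in tableaux x0 le lt mu al ->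
  strip_off z (pad x0 z la t) = t.
Proof.
move=> hmu ht; have [st tE ez] := tableaux_rcons (pad_tableaux hmu ht).
move: ht; rewrite mem_tableaux => /and3P[/eqP sh /allP ent _].
have /stripsP[sm hm] := hmu; have /stripsP[sn hn] := st.
have muE : Defs.shape (strip_off z (pad x0 z la t)) = mu.
  apply: (@eq_from_nth _ 0); rewrite sn ?sm // => r hr.
  have key c : c < nth 0 la r ->
      (c < nth 0 mu r) = (c < nth 0 (Defs.shape (strip_off z (pad x0 z la t))) r).
    move=> hc; have h : (r, c) \in cells la by rewrite mem_cells hr.
    rewrite -(ez (r, c)) // entry_tabof //= sh; case: ifP => hc2; last by rewrite eqxx.
    symmetry; apply/negP => /eqP tz; have : entry x0 t (r, c) \in al.
      by apply/ent/entry_mem; rewrite sh mem_cells sm hr.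
    by move/al_z; rewrite tz lt_irr.
  have /andP[_ h1] := hm r hr; have /andP[_ h2] := hn r hr.
  case: (ltngtP (nth 0 (Defs.shape (strip_off z (pad x0 z la t))) r) (nth 0 mu r)) => // lt_.
    by have := key _ (leq_trans lt_ h1); rewrite lt_ ltnn.
  by have := key _ (leq_trans lt_ h2); rewrite lt_ ltnn.
rewrite tE muE -[RHS](tabof_entry x0) sh; apply: eq_tabof => -[r c] h.
have := h; rewrite mem_cells sm => /andP[hr hc]; have /andP[_ hl] := hm r hr.
by rewrite entry_tabof /= ?sh ?hc // mem_cells hr (leq_trans hc hl).
Qed.

End RemoveLargest.

(** Induction on the alphabet through removal of its largest letter, which is why the variables
    enter [schur_rec] in reverse order. *)
Lemma sum_tableaux (A : comPzRingType) (X : eqType) (x0 : X) (lt : rel X) (x : X -> A)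
    (al : seq X) (la : seq nat) :
  irreflexive lt -> transitive lt -> sorted lt al -> sorted geq la ->
  (\sum_(t <- tableaux x0 (fun a b => (a == b) || lt a b) lt la al)
     \prod_(a <- flatten t) x a = schur_rec (map x (rev al)) la)%R.
Proof.
move=> lt_irr lt_trans; set le := fun a b => _.
have le_trans : transitive le := refl_closure_trans lt_trans.
elim/last_ind: al la => [|al z IH] la.
  move=> _ la_dec; rewrite /tableaux /=; case E: (sumn la) => [|m] /=; last first.
    by rewrite big_nil.
  suff -> : tab_cond x0 le lt (reshape la [::]) by rewrite big_seq1 reshapeKr ?E ?big_nil.
  have sh : Defs.shape (reshape la ([::] : seq X)) = la by apply: reshapeKl; rewrite E.
  have c0 : cells la = [::] by apply: size0nil; rewrite size_cells.
  by apply/(tab_condP _ _ _ le_trans); rewrite sh c0.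
move=> srt la_dec; have ual := sorted_uniq lt_trans lt_irr srt.
have al_z a : a \in al -> lt a z.
  move=> ha; move: srt; rewrite -cats1 => srt.
  have := sorted_ltn_index lt_trans srt a z; rewrite !mem_cat ha mem_head orbT; apply=> //.
  rewrite !index_cat ha; case: ifP => [zal|_]; last first.
    by rewrite -[X in X < _]addn0 ltn_addr ?addn0 ?index_mem.
  by move: ual; rewrite rcons_uniq zal.
have srt' : sorted lt al by move: srt; rewrite -cats1 => /cat_sorted2[].
have ual' : uniq al by move: ual; rewrite rcons_uniq => /andP[].
rewrite rev_rcons /=.
pose L := [seq t | mu <- strips la, t <- tableaux x0 le lt mu al].
have mL t : (t \in L) = (Defs.shape t \in strips la) && (t \in tableaux x0 le lt (Defs.shape t) al).
  apply/allpairsPdep/andP => [[mu [t' [h1 h2 ->]]]|[h1 h2]]; last by exists (Defs.shape t), t.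
  by have := h2; rewrite mem_tableaux => /andP[/eqP -> _].
transitivity (\sum_(t <- L) x z ^+ (sumn la - sumn (Defs.shape t)) *
    \prod_(a <- flatten t) x a)%R; last first.
  rewrite big_allpairs_dep; apply: eq_big_seq => mu hmu.
  rewrite -IH ?(strips_sorted la_dec hmu) // mulr_sumr; apply: eq_big_seq => t.
  by rewrite mem_tableaux => /andP[/eqP -> _].
apply: (big_bij_seq (h := strip_off z) (g := pad x0 z la)).
- exact: tableaux_uniq.
- apply: allpairs_uniq_dep; first exact: strips_uniq.
    by move=> mu _; apply: tableaux_uniq.
  move=> p p' /allpairsPdep[mu [t [_ h ->]]] /allpairsPdep[mu' [t' [_ h' ->]]] /= tt.
  move: h h'; rewrite !mem_tableaux -tt => /andP[/eqP <- _] /andP[/eqP <- _].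
  by [].
- move=> t ht; have [st _ _] := tableaux_rcons lt_irr lt_trans al_z la_dec ht.
  by rewrite mL st (strip_off_tableaux lt_irr lt_trans al_z la_dec ht).
- move=> t; rewrite mL => /andP[h1 h2].
  exact: (pad_tableaux lt_trans al_z la_dec h1 h2).
- by move=> t ht; apply: (pad_strip_off lt_irr lt_trans al_z la_dec ht).
- move=> t; rewrite mL => /andP[h1 h2].
  exact: (strip_off_pad lt_irr lt_trans al_z la_dec h1 h2).
move=> t; rewrite mem_tableaux => /andP[/eqP sh _].
rewrite -filter_flatten (bigID (fun a => a == z)) /=; congr (_ * _)%R; last first.
  by rewrite big_filter.
have szE : sumn (Defs.shape (strip_off z t)) = count (predC1 z) (flatten t).
  by rewrite -[LHS](size_flatten (strip_off z t)) -filter_flatten size_filter.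
have laE : sumn la = size (flatten t) by rewrite size_flatten -sh.
rewrite szE laE -(count_predC (pred1 z)) addnK.
rewrite (eq_bigr (fun=> x z)) => [|a /eqP -> //].
by rewrite big_const_seq iter_mulr_1.
Qed.

Lemma sum_tableaux_perm (A : comPzRingType) (X : eqType) (x0 : X) (lt : rel X) (x y : X -> A)
    (al : seq X) (la : seq nat) :
  irreflexive lt -> transitive lt -> sorted lt al -> sorted geq la ->
  perm_eq (map x al) (map y al) ->
  (\sum_(t <- tableaux x0 (fun a b => (a == b) || lt a b) lt la al)
     \prod_(a <- flatten t) x a =
   \sum_(t <- tableaux x0 (fun a b => (a == b) || lt a b) lt la al)
     \prod_(a <- flatten t) y a)%R.
Proof.
move=> irr tr srt la_dec xy; rewrite !sum_tableaux //; apply: schur_rec_perm.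
by rewrite !map_rev perm_rev perm_sym perm_rev perm_sym.
Qed.

(** * Coefficients of both sides *)

Lemma mcoeff_monomial_mul k (m e : 'X_{1..k}) (p : {mpoly int[k]}) :
  ((p * 'X_[m])@_e = if (m <= e)%MM then p@_(e - m)%MM else 0)%R.
Proof.
case: ifP => me; first by rewrite -{1}(submK me) addmC mcoeffMX.
rewrite mcoeffM big1 // => -[m1 m2] /= /eqP eE; rewrite mcoeffX.
case: eqP => [mE|_]; last by rewrite mulr0.
by move: me; rewrite [in (_ <= e)%MM]eE mE lem_addl.
Qed.

(** Here [G] is a polynomial standing in for the Schur power series: the coefficient at [e] of the
    product involves only the coefficients of [G] below [e]. *)
Lemma lhs_coef_mul n k la (e : 'X_{1..k}) (G : {mpoly int[k]}) :
  (forall d : 'X_{1..k}, (d <= e)%MM -> (G@_d = (schur_coef k la d)%:Z)%R) ->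
  (lhs_coef n k la e = (qpoch_prod n k * G)@_e)%R.
Proof.
move=> GE; rewrite [in RHS](mpolyE (qpoch_prod n k)) mulr_suml raddf_sum /=.
rewrite /lhs_coef big_mkcond; apply: eq_bigr => m _.
rewrite -scalerAl mcoeffZ [('X_[m] * G)%R]mulrC mcoeff_monomial_mul; case: ifP => me.
  by rewrite GE ?lem_subr.
by rewrite mulr0.
Qed.

Lemma prod_monomial k (f : seq nat -> 'I_k -> nat) (s : seq (seq nat)) :
  (\prod_(a <- s) 'X_[[multinom f a i | i < k]] =
   'X_[[multinom sumn [seq f a i | a <- s] | i < k]] :> {mpoly int[k]})%R.
Proof.
elim: s => [|a s IH].
  by rewrite big_nil -mpolyX0; congr 'X_[_]%R; apply/mnmP => i; rewrite !mnmE.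
rewrite big_cons IH -mpolyXD; congr 'X_[_]%R; apply/mnmP => i; by rewrite !mnmE.
Qed.

Lemma mem_cprod (ls : seq (seq nat)) (v : seq nat) :
  (v \in cprod ls) = (size v == size ls) &&
    all (fun i => nth 0 v i \in nth [::] ls i) (iota 0 (size ls)).
Proof.
elim: ls v => [|l ls IH] [|x v] //=.
  by apply/negP => /allpairsP[[y w] /= []].
rewrite eqSS andbCA -(addn0 1) iotaDl all_map.
rewrite -[X in _ && (_ && X)]/(all (fun i => nth 0 v i \in nth [::] ls i) (iota 0 (size ls))).
rewrite -IH; apply/allpairsP/andP => [[[y w] /= [yl wl [-> ->]]]|[xl vl]] //.
by exists (x, v).
Qed.

Lemma cprod_uniq (ls : seq (seq nat)) : all uniq ls -> uniq (cprod ls).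
Proof.
elim: ls => //= l ls IH /andP[ul uls]; apply: allpairs_uniq => //; first exact: IH.
by move=> [? ?] [? ?] _ _ /= [-> ->].
Qed.

Lemma mem_box k (e : 'X_{1..k}) a :
  (a \in box k e) = (size a == k) && [forall i : 'I_k, nth 0 a i <= e i].
Proof.
rewrite mem_cprod size_map size_enum_ord; congr andb; apply/allP/forallP => H i.
  have := H i; rewrite mem_iota ltn_ord => /(_ isT).
  rewrite (nth_map i) ?size_enum_ord // nth_ord_enum mem_iota add0n; exact.
rewrite mem_iota => /= hi; have := H (Ordinal hi).
rewrite (nth_map (Ordinal hi)) ?size_enum_ord //.
have -> : nth (Ordinal hi) (enum 'I_k) i = Ordinal hi.
  by apply: val_inj; rewrite /= nth_enum_ord.
by move=> h; rewrite -[X in _ \in X]/(iota 0 (e (Ordinal hi)).+1) mem_iota.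
Qed.

Lemma box_uniq k (e : 'X_{1..k}) : uniq (box k e).
Proof. by apply: cprod_uniq; rewrite all_map; apply/allP => i _; apply: iota_uniq. Qed.

Lemma leq_mem_sumn (s : seq nat) x : x \in s -> x <= sumn s.
Proof. by move=> /(nth_index 0) <-; apply: leq_nth_sumn. Qed.

(** Entries of a tableau of weight [d] are bounded coordinatewise by [d], so the box below [d] and
    the cube of side [D] yield the same tableaux of that weight. *)
Lemma schur_coefE k la (d : 'X_{1..k}) D :
  (forall i, d i < D) ->
  (schur_coef k la d)%:Z%R =
  ((\sum_(t <- tableaux [::] lex_le lex_lt la (words k (iota 0 D)))
     \prod_(a <- flatten t) 'X_[[multinom nth 0 a i | i < k]])@_d :> int)%R.
Proof.
move=> dD; pose wt (t : seq (seq (seq nat))) : 'X_{1..k} :=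
  [multinom sumn [seq nth 0 a i | a <- flatten t] | i < k].
rewrite raddf_sum /=.
under eq_bigr => t _ do rewrite (prod_monomial (fun a i => nth 0 a i)) mcoeffX.
rewrite -/(wt _) -natr_sum /schur_coef; set L := tableaux _ _ _ _ _.
have -> : \sum_(t <- L) (wt t == d : nat) = count (fun t => wt t == d) L.
  by rewrite -sum1_count [RHS]big_mkcond; apply: eq_bigr => t _; case: eqP.
rewrite natz; congr (Posz _); rewrite -!size_filter; apply: perm_size.
have wb : all (fun w => size w == sumn la) (words (sumn la) (box k d)).
  by apply/allP => w; rewrite mem_words => /andP[].
apply: uniq_perm.
- by rewrite filter_uniq // reshape_uniq // words_uniq // box_uniq.
- by rewrite filter_uniq // tableaux_uniq // words_uniq // iota_uniq.
move=> t; rewrite mem_filter [in RHS]mem_filter mem_reshape_words //.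
rewrite mem_tableaux /is_ssyt mem_words.
case: (Defs.shape t =P la) => [sh|_] /=; last by rewrite ?andbF.
have -> : size (flatten t) == sumn la by rewrite size_flatten -sh.
case: (tab_cond _ _ _ _); rewrite /= ?andbT ?andbF //.
have wE : (wt t == d) = [forall i : 'I_k, sumn [seq nth 0 a i | a <- flatten t] == d i].
  apply/eqP/forallP => [<- i|H]; first by rewrite mnmE.
  by apply/mnmP => i; rewrite mnmE; apply/eqP.
rewrite /weight_is -wE; case: (wt t =P d) => [wd|_]; rewrite ?andbF //= andbT.
have le_d a (i : 'I_k) : a \in flatten t -> nth 0 a i <= d i.
  move=> ha; rewrite -wd mnmE; apply: leq_mem_sumn.
  by apply/mapP; exists a.
apply/andP/allP => [[/allP sz _] a ha|al]; last split.
- have /eqP sa := sz a ha; rewrite [mem _ _]mem_words sa eqxx /=.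
  apply/(all_nthP 0) => i; rewrite sa => hi; rewrite [mem _ _]mem_iota add0n /=.
  exact: leq_ltn_trans (le_d a (Ordinal hi) ha) (dD _).
- by apply/allP => a /al; rewrite [mem _ _]mem_words => /andP[].
- apply/allP => a ha; rewrite [mem _ _]mem_box.
  have : a \in words k (iota 0 D) by apply: al.
  rewrite mem_words => /andP[-> _] /=; apply/forallP => i; exact: le_d.
Qed.

Lemma words_sorted m D : sorted lex_lt (words m (iota 0 D)).
Proof.
rewrite (sorted_pairwise lex_lt_trans); elim: m => //= m IH.
move: (words m (iota 0 D)) IH (iota_ltn_sorted 0 D) => W IH.
rewrite (sorted_pairwise ltn_trans).
elim: (iota 0 D) => //= x L IHL /andP[xL pL]; rewrite pairwise_cat IHL // andbT.
apply/andP; split.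
  apply/allrelP => _ _ /mapP[w _ ->] /allpairsP[[y v] /= [yL _ ->]] /=.
  by rewrite (allP xL _ yL).
rewrite pairwise_map; apply: sub_pairwise IH => a b /= ->.
by rewrite ltnn eqxx.
Qed.

Lemma perm_rev_words k D : perm_eq (map rev (words k (iota 0 D))) (words k (iota 0 D)).
Proof.
apply: uniq_perm.
- by rewrite map_inj_uniq ?words_uniq ?iota_uniq //; apply: can_inj revK.
- by rewrite words_uniq ?iota_uniq.
move=> a; rewrite mem_words; apply/mapP/andP => [[b]|[sa aa]].
  by rewrite mem_words => /andP[sb ab] ->; rewrite size_rev all_rev.
by exists (rev a); rewrite ?revK // mem_words size_rev all_rev sa aa.
Qed.

Definition mono (k i : nat) : {mpoly int[k]} :=
  'X_[[multinom (j == i :> nat) : nat | j < k]].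

Lemma wvec_monomial k a : size a <= k ->
  wvec (mono k) a =
  'X_[[multinom (if i < size a then nth 0 a (size a - i.+1) else 0) | i < k]].
Proof.
elim: a => [|c a IH] /= ak.
  by rewrite -mpolyX0; congr 'X_[_]%R; apply/mnmP => i; rewrite !mnmE.
rewrite IH 1?ltnW // /mono mpolyXn -mpolyXD; congr 'X_[_]%R; apply/mnmP => i.
rewrite mnmDE mulmnE !mnmE; case: (ltngtP i (size a)) => h /=.
- rewrite ltnS (ltnW h) mul0n add0n subSS.
  have -> : size a - i = (size a - i.+1).+1 by lia.
  by [].
- by have -> : i < (size a).+1 = false by lia.
- by rewrite h ltnSn subnn mul1n addn0.
Qed.

(** The last permutation is the listing of the result; deleting the first coordinate then gives the
    previous sequence, to which induction applies. *)
Lemma Zfold_inj n R r : {in words r (permutations (iota 1 n)) &, injective (Zfold n R)}.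
Proof.
elim: r => [|r IH] w w'.
  by rewrite !mem_words => /andP[/nilP -> _] /andP[/nilP -> _].
have up : uniq (permutations (iota 1 n)) by apply: permutations_uniq.
rewrite !(perm_mem (words_rcons r up)).
move=> /allpairsP[[u s] /= [hu hs ->]] /allpairsP[[u' s'] /= [hu' hs' ->]].
rewrite !Zfold_rcons; rewrite !mem_permutations in hs hs'.
have vu := vecs_Zfold R hu; have vu' := vecs_Zfold R hu'.
move=> E; have ss : s = s'.
  by rewrite -(listing_Zmap R vu hs) E (listing_Zmap R vu' hs').
move: E; rewrite (Zmap_prepend R vu hs) (Zmap_prepend R vu' hs').
have [/eqP sz _] := andP vu; have [/eqP sz' _] := andP vu'.
case/(@prepend_inj n); rewrite ?size_map ?size_iota // => _ /(IH _ _ hu hu') ->.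
by rewrite ss.
Qed.

Lemma Zfinal_Zfold n R sigmas : Zfinal n R sigmas = Zfold n R (rcons sigmas (iota 1 n)).
Proof. by []. Qed.

Lemma rcons_id_words n k sigmas : sigmas \in words k (permutations (iota 1 n)) ->
  rcons sigmas (iota 1 n) \in words k.+1 (permutations (iota 1 n)).
Proof.
rewrite !mem_words size_rcons all_rcons eqSS => /andP[-> ->]; rewrite andbT.
by rewrite [mem _ _]mem_permutations perm_refl.
Qed.

Lemma Zfinal_compat n k R sigmas : sigmas \in words k (permutations (iota 1 n)) ->
  vecs n k.+1 (Zfinal n R sigmas) /\ sorted (leS R (Zfinal n R sigmas)) (iota 1 n).
Proof.
move=> hs; rewrite Zfinal_Zfold; have vz := vecs_Zfold R (rcons_id_words hs); split=> //.
by rewrite -(listingP R vz) // Zfold_rcons (listing_Zmap R (vecs_Zfold R hs)).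
Qed.

(** The final sequence is compatible with [tdes n T], so [P] standardizes back to [T] and returns
    the sequence, from which [Zfold_inj] recovers the permutations. *)
Lemma Ptab_inj n k la T T' sigmas sigmas' : sumn la = n ->
  is_syt n la T -> is_syt n la T' ->
  sigmas \in words k (permutations (iota 1 n)) ->
  sigmas' \in words k (permutations (iota 1 n)) ->
  Ptab n T sigmas = Ptab n T' sigmas' -> T = T' /\ sigmas = sigmas'.
Proof.
move=> la_n hT hT' hs hs' E.
have [vz cz] := Zfinal_compat (tdes n T) hs.
have [vz' cz'] := Zfinal_compat (tdes n T') hs'.
have [T1 S1] := unstdK la_n hT vz cz; have [T2 S2] := unstdK la_n hT' vz' cz'.
have TT : T = T' by rewrite -T1 -T2 -/(Ptab _ _ _) E.
split=> //; subst T'; move: S2; rewrite -/(Ptab n T sigmas') -E S1 !Zfinal_Zfold.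
by move/(Zfold_inj (rcons_id_words hs) (rcons_id_words hs'))/rcons_inj => [].
Qed.

Lemma Tset_uniq n k la : sumn la = n ->
  uniq [seq Ptab n t sigmas | t <- syts n la, sigmas <- words k (permutations (iota 1 n))].
Proof.
move=> la_n; apply: allpairs_uniq; first exact: syts_uniq.
  by rewrite words_uniq // permutations_uniq.
move=> p p' /allpairsP[[T s] /= [hT hs ->]] /allpairsP[[T' s'] /= [hT' hs' ->]] /= E.
rewrite !mem_syts // in hT hT'.
by have [-> ->] := Ptab_inj la_n hT hT' hs hs' E.
Qed.

Lemma wvec_qexp k (a : seq nat) : size a = k ->
  wvec (mono k) a = 'X_[[multinom nth 0 a (k - i.+1) | i < k]].
Proof.
move=> sa; rewrite wvec_monomial ?sa //; congr 'X_[_]; apply/mnmP => i.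
by rewrite !mnmE ltn_ord.
Qed.

Lemma prod_flatten_sv (A : comPzRingType) n la T S (x : seq nat -> A) :
  is_syt n la T -> size S = n ->
  (\prod_(a <- flatten (map (map (sv S)) T)) x a = \prod_(s <- S) x s)%R.
Proof.
move=> /is_sytP[_ pT _ _] sS; rewrite -map_flatten; apply: perm_big.
by rewrite -[X in perm_eq _ X](map_nth_pred [::] sS); apply: perm_map.
Qed.

(** As the parametrization of the set of tableaux is injective, the sum over the set is a sum over
    all pairs of a standard tableau and a list of permutations. *)
Lemma rhs_polyE n k la : sumn la = n ->
  (rhs_poly n k.+1 la = \sum_(T <- syts n la)
     \sum_(sigmas <- words k (permutations (iota 1 n)))
       \prod_(s <- Zfinal n (tdes n T) sigmas) wvec (mono k.+1) s)%R.
Proof.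
move=> la_n; rewrite /rhs_poly /Tset undup_id ?Tset_uniq // big_allpairs_dep.
apply: eq_big_seq => T; rewrite mem_syts // => hT; apply: eq_big_seq => sg hs.
have [vz _] := Zfinal_compat (tdes n T) hs; have [/eqP sz /allP az] := andP vz.
rewrite -(prod_flatten_sv _ hT sz) -(prod_monomial (fun a i => nth 0 a (k.+1 - i.+1))).
apply: eq_big_seq => a ha; rewrite wvec_qexp //.
have /is_sytP[_ pT _ _] := hT.
move: ha; rewrite -map_flatten => /mapP[i]; rewrite (perm_mem pT) => hi ->.
exact: size_sv vz hi.
Qed.

Lemma qpoch_prodE n k :
  (qpoch_prod n k = \prod_(i < k) \prod_(j < n) (1 - mono k i ^+ j.+1))%R.
Proof.
apply: eq_bigr => i _; apply: eq_bigr => j _; congr (1 - _ ^+ _)%R.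
rewrite /mono; congr 'X_[_]%R; apply/mnmP => l; rewrite !mnmE.
by rewrite eq_sym.
Qed.

Lemma sum_compat_gf k (e : 'X_{1..k.+1}) D n R : (forall i, e i < D) ->
  eqc e
   (qpoch_prod n k.+1 *
    \sum_(S <- words n (words k.+1 (iota 0 D)) | sorted (leS R S) (iota 1 n))
       \prod_(s <- S) wvec (mono k.+1) s)%R
   (\sum_(sigmas <- words k (permutations (iota 1 n)))
       \prod_(s <- Zfinal n R sigmas) wvec (mono k.+1) s)%R.
Proof.
(* The indicator of the identity selects the compatible sequences on one side and the lists of
   permutations ending in the identity on the other. *)
move=> eD; pose phi tau : {mpoly int[k.+1]} := ((tau == iota 1 n)%:R)%R.
set perms := permutations (iota 1 n).
have up : uniq perms by apply: permutations_uniq.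
have idp : iota 1 n \in perms by rewrite /perms mem_permutations.
have hv i : i < k.+1 -> forall a, D <= a -> eqc e (mono k.+1 i ^+ a)%R 0%R.
  move=> hi a Da; rewrite mpolyXn; apply: (@eqc_monomial0 _ _ _ (Ordinal hi)).
  by rewrite mulmnE mnmE eqxx mul1n; apply: leq_trans Da.
have := sum_listing_gf n R phi hv; rewrite -qpoch_prodE; congr (eqc e (_ * _)%R _).
  rewrite [RHS]big_mkcond; apply: eq_big_seq => S hS; rewrite /phi.
  by rewrite (listingP R (vecs_words hS)) //; case: ifP; rewrite ?mul1r ?mul0r.
rewrite (perm_big _ (words_rcons k up)) big_allpairs_dep /=; apply: eq_big_seq => sg hsg.
rewrite (bigD1_seq (iota 1 n)) //= [X in (_ + X)%R](_ : _ = 0%R).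
  by rewrite addr0 /phi Zfold_rcons (listing_Zmap R (vecs_Zfold R hsg)) // eqxx mul1r -Zfold_rcons.
rewrite big_seq_cond big1 // => tau; rewrite /perms mem_permutations => /andP[pt nt].
by rewrite /phi Zfold_rcons (listing_Zmap R (vecs_Zfold R hsg)) // (negPf nt) mul0r.
Qed.

Theorem theorem7 (n k : nat) (la : seq nat) :
  1 <= n -> 1 <= k -> is_partition la -> sumn la = n ->
  forall e : 'X_{1..k}, lhs_coef n k la e = mcoeff e (rhs_poly n k la).
Proof.
move=> _; case: k => // k _ /andP[la_dec _] la_n e.
pose D := (\max_i e i).+1; have eD i : e i < D by rewrite ltnS leq_bigmax.
set al := words k.+1 (iota 0 D).
pose xmon (a : seq nat) : {mpoly int[k.+1]} := 'X_[[multinom nth 0 a i | i < k.+1]].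
rewrite (@lhs_coef_mul n k.+1 la e
  (\sum_(t <- tableaux [::] lex_le lex_lt la al) \prod_(a <- flatten t) xmon a)%R);
  last first.
  move=> d /mnm_lepP de; apply/esym/schur_coefE => i.
  by apply: leq_ltn_trans (de i) (eD i).
(* Symmetry permits replacing the forward reading of coordinates by the backward one, since
   reversing vectors permutes the alphabet [al]. *)
have -> : (\sum_(t <- tableaux [::] lex_le lex_lt la al)
    \prod_(a <- flatten t) xmon a =
  \sum_(t <- tableaux [::] lex_le lex_lt la al)
    \prod_(a <- flatten t) wvec (mono k.+1) a)%R.
  apply: (sum_tableaux_perm [::] lex_lt_irr lex_lt_trans (words_sorted _ _) la_dec).
  rewrite [X in perm_eq _ X](_ : _ = map xmon (map rev al)).
    by rewrite perm_sym; apply/perm_map/perm_rev_words.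
  rewrite -map_comp; apply/eq_in_map => a; rewrite mem_words => /andP[/eqP sa _] /=.
  rewrite wvec_qexp // /xmon; congr 'X_[_]%R; apply/mnmP => i.
  by rewrite !mnmE nth_rev ?sa.
rewrite (sum_standardize _ _ _ la_dec la_n) rhs_polyE // mulr_sumr.
(* Each standard tableau [T] is treated separately, with [R] its descent set. *)
have : eqc e (\sum_(T <- syts n la) qpoch_prod n k.+1 *
    \sum_(S <- words n al | sorted (leS (tdes n T) S) (iota 1 n))
       \prod_(a <- flatten (map (map (sv S)) T)) wvec (mono k.+1) a)%R
  (\sum_(T <- syts n la) \sum_(sigmas <- words k (permutations (iota 1 n)))
       \prod_(s <- Zfinal n (tdes n T) sigmas) wvec (mono k.+1) s)%R.
  apply: eqc_sum => T; rewrite mem_syts // => hT.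
  have -> : (\sum_(S <- words n al | sorted (leS (tdes n T) S) (iota 1 n))
       \prod_(a <- flatten (map (map (sv S)) T)) wvec (mono k.+1) a =
    \sum_(S <- words n al | sorted (leS (tdes n T) S) (iota 1 n))
       \prod_(s <- S) wvec (mono k.+1) s)%R.
    rewrite big_seq_cond [RHS]big_seq_cond; apply: eq_bigr => S /andP[].
    by rewrite mem_words => /andP[/eqP sS _] _; apply: prod_flatten_sv hT sS.
  exact: sum_compat_gf.
by apply; apply/mnm_lepP.
Qed.
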